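(* For every integer $n\ge1$ and every $c\in\mathbb{Q}$, $\widehat{\partial}_n^{(c)}(\mathcal{A}^0_{\mu_r})\subset\operatorname{Ker}\mathcal{L}^{\mathrm{sh}}$.
   Context: Fix a positive integer $r$; $\mu_r$ is the group of $r$-th roots of unity, $\mathcal{A}_{\mu_r}=\mathbb{Q}\langle x,y_s\mid s\in\mu_r\rangle$, $\mathcal{A}^0_{\mu_r}=\mathbb{Q}+\sum_s x\mathcal{A}_{\mu_r}y_s+\sum_{s,t,\,t\ne1}y_t\mathcal{A}_{\mu_r}y_s$, and $z=x+y_1$. $H$ is the derivation with $H(w)=\deg(w)w$ for words $w$ ($\deg$ = number of letters). $\partial_1$ is the derivation of $\mathcal{A}_{\mu_r}$ with $\partial_1(x)=xy_1$, $\partial_1(y_s)=-xy_s+y_sy_1-y_sy_s$. $\theta$ is the derivation with $\theta(u)=\frac12(uz+zu)$ for $u\in\{x\}\cup\{y_s\}$. For $c\in\mathbb{Q}$, $\widehat\theta^{(c)}$ is the $\mathbb{Q}$-linear map with $\widehat\theta^{(c)}(u)=\theta(u)$ for letters $u$ and $\widehat\theta^{(c)}(ww')=\widehat\theta^{(c)}(w)w'+w\widehat\theta^{(c)}(w')+cH(w)\partial_1(w')$ for all $w,w'$. With $\mathrm{ad}(P)(Q)=PQ-QP$, set $\widehat\partial_n^{(c)}=\frac{1}{(n-1)!}\mathrm{ad}(\widehat\theta^{(c)})^{n-1}(\partial_1)$. $\mathcal{L}^{\mathrm{sh}}:\mathcal{A}^0_{\mu_r}\to\mathbb{C}$ is the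 $\mathbb{Q}$-linear map with $\mathcal{L}^{\mathrm{sh}}(1)=1$ and $\mathcal{L}^{\mathrm{sh}}(x^{k_1-1}y_{s_1}\cdots x^{k_n-1}y_{s_n})=\lim_{M\to\infty}\sum_{M>m_1>\cdots>m_n>0}\frac{s_1^{m_1-m_2}\cdots s_{n-1}^{m_{n-1}-m_n}s_n^{m_n}}{m_1^{k_1}\cdots m_n^{k_n}}$. *)

(* Defs.v *)
From HB Require Import structures.
From mathcomp Require Import all_boot all_order all_algebra.
From mathcomp Require Import all_classical all_reals all_analysis.
From mathcomp Require Import complex.
Set Implicit Arguments. Unset Strict Implicit. Unset Printing Implicit Defensive.
Import Order.TTheory GRing.Theory Num.Theory.
Import numFieldNormedType.Exports.
Local Open Scope ring_scope.

(* The free algebra A_{mu_r} = Q<x, y_s | s in mu_r>.                   *)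
(* Letters: [None] is x, [Some j] (j : 'I_r) is y_{zeta^j}, where       *)
(* zeta = exp(2 pi i / r); so y_1 is [Some j] with j = 0.               *)
(* Elements of A are represented as finite formal Q-linear combinations *)
(* of words (lists of (coefficient, word)); two lists denote the same   *)
(* element iff they have the same coefficient function [coef].          *)
Section FreeAlg.
Variable r : nat.

Definition letter := option 'I_r.
Definition word := seq letter.
Definition fpoly := seq (rat * word).

Definition coef (P : fpoly) (w : word) : rat := \sum_(t <- P | t.2 == w) t.1.

Definition pword (w : word) : fpoly := [:: (1, w)].
Definition pzero : fpoly := [::].
Definition padd (P Q : fpoly) : fpoly := P ++ Q.
Definition pscale (a : rat) (P : fpoly) : fpoly := [seq (a * t.1, t.2) | t <- P].
Definition psub (P Q : fpoly) : fpoly := padd P (pscale (-1) Q).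
Definition pmul (P Q : fpoly) : fpoly :=
  [seq (p.1 * q.1, p.2 ++ q.2) | p <- P, q <- Q].

Definition lin (f : word -> fpoly) (P : fpoly) : fpoly :=
  flatten [seq pscale t.1 (f t.2) | t <- P].

Fixpoint derw (d : letter -> fpoly) (w : word) : fpoly :=
  match w with
  | [::] => pzero
  | u :: w' => padd (pmul (d u) (pword w')) (pmul (pword [:: u]) (derw d w'))
  end.

Definition px : fpoly := pword [:: None].
Definition py (j : 'I_r) : fpoly := pword [:: Some j].

Definition pz (hr : (0 < r)%N) : fpoly := padd px (py (Ordinal hr)).

Definition Hw (w : word) : fpoly := pscale (size w)%:R (pword w).
Definition H : fpoly -> fpoly := lin Hw.

Definition d1_letter (hr : (0 < r)%N) (u : letter) : fpoly :=
  let y1 := py (Ordinal hr) in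
  match u with
  | None => pmul px y1
  | Some j => padd (padd (pscale (-1) (pmul px (py j))) (pmul (py j) y1))
                   (pscale (-1) (pmul (py j) (py j)))
  end.
Definition d1 (hr : (0 < r)%N) : fpoly -> fpoly := lin (derw (d1_letter hr)).

Definition theta_letter (hr : (0 < r)%N) (u : letter) : fpoly :=
  pscale (1 / 2%:R) (padd (pmul (pword [:: u]) (pz hr)) (pmul (pz hr) (pword [:: u]))).
Definition theta (hr : (0 < r)%N) : fpoly -> fpoly := lin (derw (theta_letter hr)).

(* hat-theta^(c) on words, by recursion on the first letter, using the
   defining rule thetahat(w w') = thetahat(w) w' + w thetahat(w') + c H(w) d1(w')
   with w = u a letter (thetahat(u) = theta(u)). *)
Fixpoint thetahat_w (hr : (0 < r)%N) (c : rat) (w : word) : fpoly :=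
  match w with
  | [::] => pzero
  | u :: w' =>
      padd (padd (pmul (theta hr (pword [:: u])) (pword w'))
                 (pmul (pword [:: u]) (thetahat_w hr c w')))
           (pscale c (pmul (H (pword [:: u])) (d1 hr (pword w'))))
  end.
Definition thetahat (hr : (0 < r)%N) (c : rat) : fpoly -> fpoly := lin (thetahat_w hr c).

Definition ad (P Q : fpoly -> fpoly) : fpoly -> fpoly :=
  fun A => psub (P (Q A)) (Q (P A)).

Definition dhat (hr : (0 < r)%N) (c : rat) (n : nat) : fpoly -> fpoly :=
  fun A => pscale ((n.-1)`!%:R)^-1 (iter n.-1 (ad (thetahat hr c)) (d1 hr) A).

(* A^0 = Q + sum_s x A y_s + sum_{s, t<>1} y_t A y_s : spanned by the empty
   word and the words of length >= 2 that end with some y_s and start with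
   x or with y_t, t <> 1. *)
Definition adm_word (w : word) : bool :=
  match w with
  | [::] => true
  | u :: w' =>
      [&& (2 <= size w)%N,
          (if last u w' is Some _ then true else false) &
          (if u is Some t then nat_of_ord t != 0%N else true)]
  end.
Definition inA0 (P : fpoly) : Prop := forall w, coef P w != 0 -> adm_word w.

(* Decomposition w = x^{k_1-1} y_{s_1} ... x^{k_n-1} y_{s_n} into (k_i, s_i). *)
Fixpoint widx (cnt : nat) (w : word) : seq (nat * 'I_r) :=
  match w with
  | [::] => [::]
  | None :: w' => widx cnt.+1 w'
  | Some j :: w' => (cnt.+1, j) :: widx 0 w'
  end.

Variable R : realType.

Definition zeta : R[i] := Complex (cos (2 * pi / r%:R)) (sin (2 * pi / r%:R)).

(* Truncated sum.  Tsum jp mp idx, for idx = [(k_i,s_i), ..., (k_n,s_n)],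
   is  sum_{mp > m_i > ... > m_n > 0}
         s_{i-1}^{mp - m_i} s_i^{m_i - m_{i+1}} ... s_n^{m_n} / (m_i^{k_i} ... m_n^{k_n})
   where s_{i-1} = zeta^jp.  With jp = 0 (s_0 = 1) and mp = M this is the
   partial sum  sum_{M > m_1 > ... > m_n > 0} s_1^{m_1-m_2} ... s_n^{m_n} / (m_1^{k_1} ... m_n^{k_n}). *)
Fixpoint Tsum (jp mp : nat) (idx : seq (nat * 'I_r)) : R[i] :=
  match idx with
  | [::] => zeta ^+ (jp * mp)
  | (k, j) :: rest =>
      \sum_(1 <= m < mp) zeta ^+ (jp * (mp - m)) / (m%:R ^+ k) * Tsum j m rest
  end.

Definition partial_sum (w : word) (M : nat) : R[i] := Tsum 0 M (widx 0 w).

Definition Lsh_word (w : word) : R[i] :=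
  Complex (limn (fun M => @complex.Re R (partial_sum w M)))
          (limn (fun M => @complex.Im R (partial_sum w M))).

(* Q-linear extension (meaningful on A^0). *)
Definition Lsh (P : fpoly) : R[i] := \sum_(t <- P) ratr t.1 * Lsh_word t.2.

End FreeAlg.

(* Main.v *)
Require Import Defs.
From HB Require Import structures.
From mathcomp Require Import all_boot all_order all_algebra.
From mathcomp Require Import all_classical all_reals all_analysis.
From mathcomp Require Import complex.
From mathcomp Require Import ring lra freeg.
Import Order.TTheory GRing.Theory Num.Theory.
Import numFieldNormedType.Exports.
Local Open Scope ring_scope.

(** The derivation [d1] is the difference between shuffling and stuffling with
    [y_1].  Attach to a word [w] the sequence [a_w] whose finite differences at
    [0] are the partial sums of the series defining [L(w)] (equivalently, expand
    the iterated integral in [t / (t - 1)] instead of [t]).  In these coordinates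
    [d1] is multiplication by [m |-> - (1 + 1/2 + ... + 1/m)].  Call [Jop e] the
    operator that obeys the recursion of [d1] on the first letter of a word, with
    an operator [e] inserted between the two letters created by [d1]; if [e] is
    multiplication by [p], then [Jop e] is multiplication by
    [q m = - \sum_(1 <= k <= m) p k / k].  The operators generated from the
    identity by left multiplication by [z] and by [Jop] commute with [d1] and are
    stable under the commutator with [thetahat], which sends [Jop e] to
    [Jop (z e + [thetahat, e] + c d1 e)].  Hence [dhat n] is a multiple of some
    [Jop e], so it multiplies [a_w] by a [q] with [q 0 = 0].  This allows to
    replace [a_w 0 = 0] by [- L(w)], whose effect is to replace the partial sums
    by the remainders of the series; these are [O (1 / sqrt N)], and multiplication
    by [q] costs only powers of [log N].  So the partial sums of [dhat n w] tend
    to [0]. *)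

Set Implicit Arguments.
Unset Strict Implicit.

(** * Operators on the free module *)

Section FreeModule.
Variables (K : fieldType) (X : choiceType).
Implicit Types (D : {freeg X / K}).

Lemma scale_freegU (c k : K) (x : X) :
  c *: << k *g x >> = << c * k *g x >> :> {freeg X / K}.
Proof. by apply/eqP/freeg_eqP => y; rewrite coeffZ !coeffU mulrA. Qed.

Lemma fglift_is_linear (M : lmodType K) (f : X -> M) : linear (fglift f).
Proof.
move=> c D1 D2; have addf := lift_is_additive f.
pose F : {additive _ -> _} :=
  HB.pack (fglift f) (GRing.isZmodMorphism.Build _ _ (fglift f) addf).
have FD D D' : fglift f (D + D') = fglift f D + fglift f D' := raddfD F D D'.
have Fs I (s : seq I) (G : I -> {freeg X / K}) :
  fglift f (\sum_(i <- s) G i) = \sum_(i <- s) fglift f (G i) by exact: (raddf_sum F).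
rewrite FD; congr (_ + _).
rewrite -(freeg_sumE D1) scaler_sumr !Fs scaler_sumr; apply: eq_bigr => x _.
by rewrite scale_freegU !liftU scalerA.
Qed.

HB.instance Definition _ (M : lmodType K) (f : X -> M) :=
  GRing.isLinear.Build K {freeg X / K} M *:%R (fglift f) (fglift_is_linear f).

Lemma liftU1 (M : lmodType K) (f : X -> M) (x : X) : fglift f << x >> = f x.
Proof. by rewrite liftU scale1r. Qed.

Lemma freeg_lin_ind (P : {freeg X / K} -> Prop) :
  P 0 -> (forall c D D', P D -> P D' -> P (c *: D + D')) ->
  (forall x, P << x >>) -> forall D, P D.
Proof.
move=> P0 PD Px D; rewrite -(freeg_sumE D); elim/big_ind: _ => //.
  by move=> D1 D2 h1 h2; rewrite -[D1]scale1r; apply: PD.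
move=> x _; rewrite -[<< _ *g _ >>]addr0 -[coeff x D]mulr1 -scale_freegU.
exact: PD.
Qed.

End FreeModule.

Ltac freeg_ring :=
  apply/eqP/freeg_eqP => ?; rewrite !(coeffD, coeffN, coeffZ, coeff0) /=; ring.
Ltac freeg_field :=
  apply/eqP/freeg_eqP => ?; rewrite !(coeffD, coeffN, coeffZ, coeff0) /=;
  field; rewrite ?pnatr_eq0 //.

(** * Operators generated by left multiplication by [z] and by [Jop] *)

Section Operators.
Variables (K : numFieldType) (r : nat) (hr : (0 < r)%N).
Local Notation A := {freeg (word r) / K}.
Local Notation y1 := (Some (Ordinal hr) : letter r).
Local Notation x := (None : letter r).

Definition lmul (u : letter r) : A -> A := fglift (fun w : word r => << u :: w >> : A).
HB.instance Definition _ (u : letter r) := GRing.Linear.on (lmul u).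

Lemma lmulU u (w : word r) : lmul u << w >> = << u :: w >>.
Proof. exact: liftU1. Qed.

(* Locked, since [linearD] would otherwise match [zmul g], which unfolds to a sum. *)
Fact zmul_key : unit. Proof. by []. Qed.
Definition zmul : A -> A := locked_with zmul_key (fun g => lmul x g + lmul y1 g).
Lemma zmulE (g : A) : zmul g = lmul x g + lmul y1 g.
Proof. by rewrite /zmul unlock. Qed.
Lemma zmul_is_linear : linear zmul.
Proof. by move=> c g h; rewrite !zmulE !linearP; freeg_ring. Qed.
HB.instance Definition _ := GRing.isLinear.Build K A A *:%R zmul zmul_is_linear.

Lemma lmulD u (g h : A) : lmul u (g + h) = lmul u g + lmul u h. Proof. exact: linearD. Qed.
Lemma lmulN u (g : A) : lmul u (- g) = - lmul u g. Proof. exact: linearN. Qed.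
Lemma lmulZ u k (g : A) : lmul u (k *: g) = k *: lmul u g. Proof. exact: linearZ. Qed.
Lemma lmul0 u : lmul u 0 = 0. Proof. exact: linear0. Qed.
Lemma zmulD (g h : A) : zmul (g + h) = zmul g + zmul h. Proof. exact: linearD. Qed.
Lemma zmulN (g : A) : zmul (- g) = - zmul g. Proof. exact: linearN. Qed.
Lemma zmulZ k (g : A) : zmul (k *: g) = k *: zmul g. Proof. exact: linearZ. Qed.
Lemma zmul0 : zmul 0 = 0. Proof. exact: linear0. Qed.
Definition mulE := (lmulD, lmulN, lmulZ, lmul0, zmulD, zmulN, zmulZ, zmul0).

(* If [d1 u] is the sum of the two-letter words [u' v'], this is the sum of the
   [u' * F (v' * g)]. *)
Definition d1_split (u : letter r) (F : A -> A) (g : A) : A :=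
  match u with
  | None => lmul x (F (lmul y1 g))
  | Some j => lmul u (F (lmul y1 g)) - lmul x (F (lmul u g)) - lmul u (F (lmul u g))
  end.

Lemma d1_splitx F g : d1_split x F g = lmul x (F (lmul y1 g)).
Proof. by []. Qed.

Lemma d1_splity j F g : d1_split (Some j) F g =
  lmul (Some j) (F (lmul y1 g)) - lmul x (F (lmul (Some j) g))
  - lmul (Some j) (F (lmul (Some j) g)).
Proof. by []. Qed.

Definition d1_splitE := (d1_splitx, d1_splity).

Fixpoint Jword (F : A -> A) (w : word r) : A :=
  match w with
  | [::] => 0
  | u :: w' => lmul u (Jword F w') + d1_split u F << w' >>
  end.

(** Operators are reified as trees so that composition with [d1] and the commutator with [thetahat]
    become recursive functions on trees, and a multiplier can be read off each tree. *)
Inductive op :=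
  | Iop | Zop of op | Jop of op | Aop of op & op | Sop of K & op.

Fixpoint opA (e : op) : A -> A :=
  match e with
  | Iop => id
  | Zop e => fun g => zmul (opA e g)
  | Jop e => fglift (Jword (opA e))
  | Aop e f => fun g => opA e g + opA f g
  | Sop k e => fun g => k *: opA e g
  end.

Lemma opA_is_linear e : linear (opA e).
Proof.
elim: e => [|e IH|e _|e IHe f IHf|k e IH] c g h //=.
- by rewrite IH linearP.
- by rewrite linearP.
- by rewrite IHe IHf; freeg_ring.
- by rewrite IH; freeg_ring.
Qed.
HB.instance Definition _ e := GRing.isLinear.Build K A A *:%R (opA e) (opA_is_linear e).

Lemma opAD e (g h : A) : opA e (g + h) = opA e g + opA e h. Proof. exact: linearD. Qed.
Lemma opAN e (g : A) : opA e (- g) = - opA e g. Proof. exact: linearN. Qed.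
Lemma opAZ e k (g : A) : opA e (k *: g) = k *: opA e g. Proof. exact: linearZ. Qed.
Lemma opA0 e : opA e 0 = 0. Proof. exact: linear0. Qed.
Definition linE := (mulE, (opAD, opAN, opAZ, opA0)).

Lemma opA_I g : opA Iop g = g. Proof. by []. Qed.
Lemma opA_Z e g : opA (Zop e) g = zmul (opA e g). Proof. by []. Qed.
Lemma opA_A e f g : opA (Aop e f) g = opA e g + opA f g. Proof. by []. Qed.
Lemma opA_S k e g : opA (Sop k e) g = k *: opA e g. Proof. by []. Qed.
Lemma opA_JU e w : opA (Jop e) << w >> = Jword (opA e) w. Proof. exact: liftU1. Qed.
Definition opAE := (opA_I, opA_Z, opA_A, opA_S).
Arguments opA : simpl never.

Lemma opA_J u e g :
  opA (Jop e) (lmul u g) = lmul u (opA (Jop e) g) + d1_split u (opA e) g.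
Proof.
elim/freeg_lin_ind: g => [|c g h Hg Hh|w].
- by case: u => [j|] /=; rewrite !linE; freeg_ring.
- by rewrite !linE Hg Hh; case: u {Hg Hh} => [j|] /=; rewrite !linE; freeg_ring.
- by rewrite lmulU !opA_JU.
Qed.

Lemma opA_J1 e : opA (Jop e) << [::] >> = 0.
Proof. exact: opA_JU. Qed.

Lemma lmul_ind (P : A -> Prop) : P 0 ->
  (forall c g h, P g -> P h -> P (c *: g + h)) -> P << [::] >> ->
  (forall u g, P g -> P (lmul u g)) -> forall g, P g.
Proof.
move=> P0 PD P1 PM; apply: freeg_lin_ind => // w.
by elim: w => [//|u w IH]; rewrite -lmulU; apply: PM.
Qed.

Lemma opA_zmul e g : opA e (zmul g) = zmul (opA e g).
Proof.
elim: e => [|e IH|e IH|e IHe f IHf|k e IH]; rewrite ?opAE //.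
- by rewrite IH.
- by rewrite !zmulE opAD !opA_J /=; freeg_ring.
- by rewrite IHe IHf zmulD.
- by rewrite IH zmulZ.
Qed.

(** Since x = z - y_1 and every operator commutes with [z], occurrences of x under an operator can
    be traded for y_1; this brings letter computations to a normal form. *)
Lemma opA_x e g : opA e (lmul x g) = zmul (opA e g) - opA e (lmul y1 g).
Proof. by rewrite -opA_zmul {1}zmulE opAD addrK. Qed.

(** Operator form of the product of two sums: splitting the double sum by its larger index gives the
    first two terms of [h], and the term in [zmul] corrects the diagonal, which they count twice. *)
Lemma opA_JJ e f h :
  (forall g, opA h g = opA e (opA (Jop f) g) + opA (Jop e) (opA f g)
                       + zmul (opA e (opA f g))) ->
  forall g, opA (Jop e) (opA (Jop f) g) = opA (Jop h) g.
Proof.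
move=> Hh; elim/lmul_ind => [|k g1 g2 H1 H2||u g IH].
- by rewrite !linE.
- by rewrite !linE H1 H2.
- by rewrite !opA_J1 opA0.
- rewrite !opA_J opAD opA_J IH; case: u => [j|] /=;
  rewrite ?linE !Hh; do ?(rewrite !opA_J /= ?linE); rewrite !opA_x !zmulE ?linE; freeg_ring.
Qed.

(** The composite of [d1] and [e] in either order: [del1_op] and [op_del1] share their right-hand
    side, which expresses commutation. The [Jop] case is [opA_JJ] with [Jop Iop] as one factor. *)
Fixpoint d1op (e : op) : op :=
  match e with
  | Iop => Jop Iop
  | Zop e => Zop (d1op e)
  | Jop e => Jop (Aop (Aop (Jop e) (d1op e)) (Zop e))
  | Aop e f => Aop (d1op e) (d1op f)
  | Sop k e => Sop k (d1op e)
  end.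

Local Notation del1 := (opA (Jop Iop)).

Lemma del1_op e g : del1 (opA e g) = opA (d1op e) g.
Proof.
elim: e g => [|e IH|e IH|e IHe f IHf|k e IH] g //=; rewrite ?opAE ?opA_zmul ?linE.
- by rewrite IH.
- by apply: opA_JJ => h; rewrite !opAE -IH.
- by rewrite IHe IHf.
- by rewrite IH.
Qed.

Lemma op_del1 e g : opA e (del1 g) = opA (d1op e) g.
Proof.
elim: e g => [|e IH|e IH|e IHe f IHf|k e IH] g //=; rewrite ?opAE ?opA_zmul ?linE.
- by rewrite IH.
- apply: opA_JJ => h; rewrite !opAE IH; freeg_ring.
- by rewrite IHe IHf.
- by rewrite IH.
Qed.

(** * The map [thetahat] and its commutators *)

Variable c : K.

Fixpoint thword (w : word r) : A :=
  match w with
  | [::] => 0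
  | u :: w' => 2^-1 *: (lmul u (zmul << w' >>) + zmul << u :: w' >>)
               + lmul u (thword w') + c *: lmul u (del1 << w' >>)
  end.
Definition thA : A -> A := fglift thword.
HB.instance Definition _ := GRing.Linear.on thA.

Lemma thAD (g h : A) : thA (g + h) = thA g + thA h. Proof. exact: linearD. Qed.
Lemma thAZ k (g : A) : thA (k *: g) = k *: thA g. Proof. exact: linearZ. Qed.
Lemma thAN (g : A) : thA (- g) = - thA g. Proof. exact: linearN. Qed.
Lemma thA0 : thA 0 = 0. Proof. exact: linear0. Qed.
Definition thE := (linE, (thAD, thAN, thAZ, thA0)).
Arguments thA : simpl never.

Lemma thA1 : thA << [::] >> = 0.
Proof. exact: liftU1. Qed.

Lemma thA_lmul u g : thA (lmul u g) =
  2^-1 *: (lmul u (zmul g) + zmul (lmul u g)) + lmul u (thA g) + c *: lmul u (del1 g).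
Proof.
elim/freeg_lin_ind: g => [|k g h Hg Hh|w].
- by rewrite !thE; freeg_field.
- by rewrite !thE Hg Hh; freeg_field.
- by rewrite lmulU /thA !liftU1.
Qed.

Lemma thA_zmul g : thA (zmul g) = zmul (zmul g) + zmul (thA g) + c *: zmul (del1 g).
Proof.
rewrite [in LHS]zmulE thAD !thA_lmul !zmulE !linE. freeg_field.
Qed.

(** The commutator of [thA] with [e], see [brop_comm]. In the [Jop] case each of the two letters
    around [e] contributes half a [z] between them, whence [Zop e]; the term in [c] is the
    correction of [thetahat] at the first letter. *)
Fixpoint brop (e : op) : op :=
  match e with
  | Iop => Sop 0 Iop
  | Zop e => Aop (Aop (Zop (Zop e)) (Sop c (Zop (d1op e)))) (Zop (brop e))
  | Jop e => Jop (Aop (Aop (Zop e) (brop e)) (Sop c (d1op e)))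
  | Aop e f => Aop (brop e) (brop f)
  | Sop k e => Sop k (brop e)
  end.

Lemma brop_comm e g : thA (opA e g) = opA e (thA g) + opA (brop e) g.
Proof.
elim: e g => [|e IH|e IH|e IHe f IHf|k e IH] g.
- by rewrite /= !opAE scale0r addr0.
- by rewrite /= !opAE thA_zmul IH del1_op zmulD; freeg_ring.
- elim/lmul_ind: g => [|k g1 g2 H1 H2||u g IHg].
  + by rewrite !thE addr0.
  + by rewrite !thE H1 H2; freeg_ring.
  + by rewrite thA1 !opA_J1 !thE addr0.
  + have brJ : brop (Jop e) = Jop (Aop (Aop (Zop e) (brop e)) (Sop c (d1op e))) by [].
    rewrite opA_J thAD thA_lmul IHg thA_lmul brJ !linE !opA_zmul !opA_J.
    (* Both orders of composing [d1] with [Jop e] become the same tree, so these terms cancel in the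
       final comparison. *)
    rewrite del1_op op_del1.
    case: u => [j|]; rewrite !d1_splitE !opAE ?thE !thA_lmul !IH !thA_lmul ?linE;
      rewrite ?opA_zmul !del1_op; freeg_field.
- by rewrite /= !opAE thAD IHe IHf; freeg_ring.
- by rewrite /= !opAE thAZ IH; freeg_ring.
Qed.
End Operators.

(** * The operators of the statement in the free module *)

Section Interpretation.
Variables (K : numFieldType) (r : nat) (hr : (0 < r)%N).
Local Notation A := {freeg (word r) / K}.
Local Notation y1 := (Some (Ordinal hr) : letter r).
Local Notation x := (None : letter r).
Local Notation del1 := (@opA K r hr (Jop (Iop K))).

(** Scalars are extended from the rationals to [K], later the complex numbers, where the sequences
    of words live. By [coeff_freeg_of] and injectivity of [ratr], the support of an element is
    preserved. *)
Definition freeg_of (P : fpoly r) : A := \sum_(t <- P) ratr t.1 *: << t.2 >>.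

Lemma freeg_of0 : freeg_of (pzero r) = 0. Proof. exact: big_nil. Qed.

Lemma freeg_ofD P Q : freeg_of (padd P Q) = freeg_of P + freeg_of Q.
Proof. exact: big_cat. Qed.

Lemma freeg_ofZ a P : freeg_of (pscale a P) = ratr a *: freeg_of P.
Proof.
rewrite /freeg_of big_map scaler_sumr; apply: eq_bigr => t _.
by rewrite rmorphM scalerA.
Qed.

Lemma freeg_ofB P Q : freeg_of (psub P Q) = freeg_of P - freeg_of Q.
Proof. by rewrite freeg_ofD freeg_ofZ rmorphN rmorph1 scaleN1r. Qed.

Lemma freeg_of_word w : freeg_of (pword w) = << w >>.
Proof. by rewrite /freeg_of big_seq1 rmorph1 scale1r. Qed.

Lemma freeg_ofM P Q :
  freeg_of (pmul P Q) = \sum_(p <- P) ratr p.1 *: foldr (@lmul K r) (freeg_of Q) p.2.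
Proof.
rewrite /freeg_of big_allpairs_dep; apply: eq_bigr => p _ /=.
have foldr_sum w : foldr (@lmul K r) (freeg_of Q) w =
    \sum_(q <- Q) ratr q.1 *: << w ++ q.2 >>.
  elim: w => [//|u w IH]; rewrite /= IH linear_sum; apply: eq_bigr => q _.
  by rewrite [LHS]linearZ /= lmulU.
rewrite foldr_sum scaler_sumr; apply: eq_bigr => q _.
by rewrite rmorphM scalerA.
Qed.

Lemma freeg_of_lin f P : freeg_of (lin f P) = fglift (fun w => freeg_of (f w)) (freeg_of P).
Proof.
rewrite /freeg_of /lin big_flatten big_map linear_sum; apply: eq_bigr => t _.
by rewrite -/(freeg_of _) freeg_ofZ linearZ /= liftU1.
Qed.


Lemma coeff_freeg_of P w : coeff w (freeg_of P) = ratr (coef P w).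
Proof.
rewrite /freeg_of /coef raddf_sum rmorph_sum [RHS]big_mkcond; apply: eq_bigr => t _ /=.
by rewrite coeffZ coeffU mul1r; case: eqP => _; rewrite ?mulr1 ?mulr0.
Qed.

Lemma freeg_of_lmul u P : freeg_of (pmul (pword [:: u]) P) = lmul u (freeg_of P).
Proof. by rewrite freeg_ofM big_seq1 /= rmorph1 scale1r. Qed.

Lemma freeg_of_d1_letter u P :
  freeg_of (pmul (d1_letter hr u) P) = d1_split hr u id (freeg_of P).
Proof.
rewrite freeg_ofM; case: u => [j|]; rewrite d1_splitE;
  rewrite !big_cons big_nil /= ?(mulr1, mul1r, rmorphN, rmorph1) ?scaleN1r ?scale1r addr0 //.
by rewrite addrC -!addrA; congr (_ + _); rewrite addrC.
Qed.

Lemma freeg_of_derw w : freeg_of (derw (d1_letter hr) w) = Jword hr id w.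
Proof.
elim: w => [|u w IH]; first exact: freeg_of0.
by rewrite /= freeg_ofD freeg_of_d1_letter freeg_of_lmul IH freeg_of_word addrC.
Qed.

Lemma freeg_of_d1 P : freeg_of (d1 hr P) = del1 (freeg_of P).
Proof.
by rewrite freeg_of_lin; congr (fglift _ _); apply/funext => w; rewrite freeg_of_derw.
Qed.

Lemma freeg_of_theta_letter u P :
  freeg_of (pmul (theta hr (pword [:: u])) P) =
  2^-1 *: (lmul u (zmul hr (freeg_of P)) + zmul hr (lmul u (freeg_of P))).
Proof.
rewrite freeg_ofM !zmulE lmulD !big_cons big_nil /=.
by rewrite !(mulr1, mul1r) fmorphV rmorph_nat; freeg_field.
Qed.

Lemma freeg_of_thetahat c P : freeg_of (thetahat hr c P) = thA hr (ratr c) (freeg_of P).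
Proof.
rewrite freeg_of_lin; congr (fglift _ _); apply/funext => w.
elim: w => [|u w IH]; first exact: freeg_of0.
have -> : thetahat_w hr c (u :: w) =
    padd (padd (pmul (theta hr (pword [:: u])) (pword w))
               (pmul (pword [:: u]) (thetahat_w hr c w)))
         (pscale c (pmul (H (pword [:: u])) (d1 hr (pword w)))) by [].
rewrite freeg_ofD [in LHS](freeg_ofD (pmul (theta _ _) _)).
rewrite (freeg_of_theta_letter u (pword w)) (freeg_of_lmul u (thetahat_w hr c w)).
rewrite freeg_ofZ IH freeg_ofM.
rewrite !big_cons big_nil /= freeg_of_d1 !freeg_of_word lmulU.
by rewrite !mulr1 rmorph1 scale1r addr0.
Qed.

(** The operator inside [Jop] after [n] commutators: by [brop_J] the outer [Jop] persists and only
    its argument evolves. *)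
Fixpoint dhat_op (c : K) (n : nat) : op K :=
  if n is n'.+1 then
    let e := dhat_op c n' in Aop (Aop (Zop e) (brop c e)) (Sop c (d1op e))
  else Iop K.

Lemma brop_J c n : brop c (Jop (dhat_op c n)) = Jop (dhat_op c n.+1).
Proof. by []. Qed.

Lemma freeg_of_dhat c n P : freeg_of (dhat hr c n.+1 P) =
  (n`!%:R)^-1 *: opA hr (Jop (dhat_op (ratr c) n)) (freeg_of P).
Proof.
rewrite freeg_ofZ fmorphV rmorph_nat; congr (_ *: _).
rewrite [n.+1.-1]/=; elim: n P => [|n IH] P; first exact: freeg_of_d1.
rewrite iterS /ad freeg_ofB freeg_of_thetahat !IH freeg_of_thetahat brop_comm brop_J.
by rewrite addrC addKr.
Qed.

End Interpretation.

(** * Sequences and binomial transforms *)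

Section Sequences.
Variable K : numFieldType.
Implicit Types (a b p : nat -> K) (s : K).

Definition psum a (m : nat) : K := \sum_(j < m.+1) a j.

(** The sum over [i < m] of [(1 - s)^(m-1-i) * b i]. Its transform obeys a recursion of ratio [s]
    ([btrans_gsum]), as do the inner sums created by y_s. *)
Fixpoint gsum s b (m : nat) : K :=
  if m is m'.+1 then (1 - s) * gsum s b m' + b m' else 0.

Definition bdiff a (m : nat) : K := a m - a m.+1.
(** The binomial transform, sum over [k <= n] of [(-1)^k binomial(n, k) a k], as an iterated
    difference, which suits induction through [btransS]. *)
Definition btrans a (n : nat) : K := iter n bdiff a 0.

Lemma psum0 a : psum a 0 = a 0.
Proof. by rewrite /psum big_ord1. Qed.

Lemma psumS a m : psum a m.+1 = psum a m + a m.+1.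
Proof. by rewrite /psum big_ord_recr. Qed.

Lemma psumD a b m : psum (fun i => a i + b i) m = psum a m + psum b m.
Proof. exact: big_split. Qed.

Lemma psumZ k a m : psum (fun i => k * a i) m = k * psum a m.
Proof. by rewrite /psum mulr_sumr. Qed.

Lemma gsumD s a b m : gsum s (fun i => a i + b i) m = gsum s a m + gsum s b m.
Proof. by elim: m => [|m IH] /=; rewrite ?addr0 // IH; ring. Qed.

Lemma gsumZ s k a m : gsum s (fun i => k * a i) m = k * gsum s a m.
Proof. by elim: m => [|m IH] /=; rewrite ?mulr0 // IH; ring. Qed.

Lemma gsum1S b m : gsum 1 b m.+1 = b m.
Proof. by rewrite /= subrr mul0r add0r. Qed.

Lemma btrans0 a : btrans a 0 = a 0. Proof. by []. Qed.

Lemma btransS a n : btrans a n.+1 = btrans (bdiff a) n.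
Proof. by rewrite /btrans iterSr. Qed.

Lemma eq_btrans a b n : a =1 b -> btrans a n = btrans b n.
Proof. by move=> /funext ->. Qed.

Lemma btrans_lin k a b n :
  btrans (fun m => k * a m + b m) n = k * btrans a n + btrans b n.
Proof.
elim: n a b => [//|n IH] a b; rewrite !btransS -IH; apply: eq_btrans => m.
by rewrite /bdiff; ring.
Qed.

Lemma btransD a b n : btrans (fun m => a m + b m) n = btrans a n + btrans b n.
Proof.
rewrite -[btrans a n]mul1r -btrans_lin; apply: eq_btrans => m.
by rewrite mul1r.
Qed.

Lemma btransZ k a n : btrans (fun m => k * a m) n = k * btrans a n.
Proof.
elim: n a => [//|n IH] a; rewrite !btransS -IH; apply: eq_btrans => m.
by rewrite /bdiff; ring.
Qed.

Lemma btrans_shift a n : btrans (fun m => a m.+1) n = btrans a n - btrans a n.+1.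
Proof.
elim: n a => [|n IH] a; first by rewrite btransS !btrans0 /bdiff; ring.
by rewrite [btrans a n.+2]btransS [btrans a n.+1]btransS -IH btransS.
Qed.

(** Amounts to [k binomial(n+1, k) = (n+1) binomial(n, k-1)]. Read backwards it describes division
    by [m], see [btrans_divn]. *)
Lemma btrans_muln a n :
  btrans (fun m => m%:R * a m) n.+1 = n.+1%:R * (btrans a n.+1 - btrans a n).
Proof.
elim: n a => [|n IH] a.
  by rewrite !btransS !btrans0 /bdiff; ring.
have -> : btrans (fun m => m%:R * a m) n.+2 =
    btrans (fun m => m%:R * bdiff a m) n.+1 - btrans (fun m => a m.+1) n.+1.
  rewrite btransS -[- _]mulN1r -btransZ -btransD; apply: eq_btrans => m.
  by rewrite /bdiff -[m.+1%:R]natr1; ring.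
rewrite IH btrans_shift -!btransS -[n.+2%:R]natr1; ring.
Qed.

Lemma btrans_delta k n : btrans (fun m => if m == 0%N then k else 0) n = k.
Proof.
elim: n k => [//|n IH] k; rewrite btransS -{2}(IH k); apply: eq_btrans => -[|m];
by rewrite /bdiff /= subr0.
Qed.

Lemma btrans_psum a n : btrans (psum a) n.+1 = btrans a n.+1 - btrans a n.
Proof.
have := btrans_shift (psum a) n.
rewrite (@eq_btrans _ (fun m => psum a m + a m.+1)); last exact: psumS.
rewrite btransD btrans_shift => /(canRL (addKr _)) H.
have -> : btrans (psum a) n.+1 =
  - (- btrans (psum a) n + (btrans (psum a) n - btrans (psum a) n.+1)) by ring.
rewrite -H; ring.
Qed.

Lemma btrans_gsum s b n :
  btrans (gsum s b) n.+1 = s * btrans (gsum s b) n - btrans b n.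
Proof.
have := btrans_shift (gsum s b) n => /= H.
have := btrans_lin (1 - s) (gsum s b) b n; rewrite H => {}H.
have -> : btrans (gsum s b) n.+1 =
  btrans (gsum s b) n - (btrans (gsum s b) n - btrans (gsum s b) n.+1) by ring.
rewrite H; ring.
Qed.

Lemma btrans_divn a t n : (forall m, t m.+1 = m.+1%:R^-1 * a m.+1) -> a 0 = 0 ->
  btrans t n.+1 = btrans t n + n.+1%:R^-1 * btrans a n.+1.
Proof.
move=> Ht a0; have -> : btrans a n.+1 = btrans (fun m => m%:R * t m) n.+1.
  apply: eq_btrans => -[|m]; first by rewrite mul0r.
  by rewrite Ht mulrA divff ?mul1r // pnatr_eq0.
rewrite btrans_muln mulrA mulVf ?pnatr_eq0 // mul1r; ring.
Qed.

(** The sum effectively starts at 1, since [0^-1 = 0]. *)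
Definition jseq p (m : nat) : K := - psum (fun k => k%:R^-1 * p k) m.

Lemma jseq0 p : jseq p 0 = 0.
Proof. by rewrite /jseq psum0 invr0 mul0r oppr0. Qed.

Lemma jseqS p m : jseq p m.+1 = jseq p m - m.+1%:R^-1 * p m.+1.
Proof. by rewrite /jseq psumS; ring. Qed.

(** [xseq] and [yseq] are the counterparts, before the transform, of prepending x and y_s to a word
    ([btrans_x], [btrans_y]). *)
Definition xseq a m : K := m%:R^-1 * psum a m.
Definition yseq s a m : K := - (s * m%:R^-1 * gsum s (psum a) m).

Lemma yseq1S a m : yseq 1 a m.+1 = - (m.+1%:R^-1 * psum a m).
Proof. by rewrite /yseq gsum1S mul1r. Qed.

Lemma xseqD a b m : xseq (fun i => a i + b i) m = xseq a m + xseq b m.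
Proof. by rewrite /xseq psumD mulrDr. Qed.

Lemma xseqZ k a m : xseq (fun i => k * a i) m = k * xseq a m.
Proof. by rewrite /xseq psumZ; ring. Qed.

Lemma yseqD s a b m : yseq s (fun i => a i + b i) m = yseq s a m + yseq s b m.
Proof.
have -> : yseq s (fun i => a i + b i) m =
  - (s * m%:R^-1 * gsum s (fun i => psum a i + psum b i) m).
  by rewrite /yseq; congr (- (_ * gsum s _ m)); apply/funext => i; rewrite psumD.
by rewrite gsumD /yseq; ring.
Qed.

Lemma yseqZ s k a m : yseq s (fun i => k * a i) m = k * yseq s a m.
Proof.
have -> : yseq s (fun i => k * a i) m =
  - (s * m%:R^-1 * gsum s (fun i => k * psum a i) m).
  by rewrite /yseq; congr (- (_ * gsum s _ m)); apply/funext => i; rewrite psumZ.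
by rewrite gsumZ /yseq; ring.
Qed.

Lemma zseqE a m : xseq a m + yseq 1 a m = m%:R^-1 * a m.
Proof.
case: m => [|m]; first by rewrite /xseq /yseq invr0 !(mul0r, mulr0); ring.
by rewrite yseq1S /xseq psumS; ring.
Qed.

(** Summation by parts: the increment of [jseq p] times the previous prefix sum of [a] is
    [p * yseq 1 a]. *)
Lemma jseq_psum p a m :
  jseq p m * psum a m = psum (fun i => jseq p i * a i + p i * yseq 1 a i) m.
Proof.
elim: m => [|m IH].
  by rewrite !psum0 jseq0 /yseq /= mulr0 oppr0; ring.
by rewrite psumS [RHS]psumS -IH jseqS yseq1S; ring.
Qed.

Lemma jseq_x p a m :
  jseq p m * xseq a m
  = xseq (fun i => jseq p i * a i) m + xseq (fun i => p i * yseq 1 a i) m.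
Proof. by rewrite -xseqD /xseq -jseq_psum; ring. Qed.

Lemma jseq_gsum s p a m (c := fun i => p i * yseq s a i) :
  s * (jseq p m * gsum s (psum a) m) =
  s * gsum s (fun i => jseq p i * psum a i) m + psum c m - s * gsum s (psum c) m.
Proof.
elim: m => [|m IH].
  by rewrite /= psum0 /c /yseq /= !mulr0 oppr0 mulr0; ring.
have cS : c m.+1 = - (s * m.+1%:R^-1 * p m.+1 * gsum s (psum a) m.+1).
  by rewrite /c /yseq; ring.
rewrite psumS cS jseqS.
have -> : gsum s (fun i => jseq p i * psum a i) m.+1 =
  (1 - s) * gsum s (fun i => jseq p i * psum a i) m + jseq p m * psum a m by [].
have -> : gsum s (psum c) m.+1 = (1 - s) * gsum s (psum c) m + psum c m by [].
have E : s * (jseq p m * gsum s (psum a) m.+1) =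
  (1 - s) * (s * (jseq p m * gsum s (psum a) m)) + s * jseq p m * psum a m.
  by rewrite /=; ring.
have -> : s * ((jseq p m - m.+1%:R^-1 * p m.+1) * gsum s (psum a) m.+1) =
  s * (jseq p m * gsum s (psum a) m.+1) - s * m.+1%:R^-1 * p m.+1 * gsum s (psum a) m.+1.
  by ring.
by rewrite E IH; ring.
Qed.

(** Mirrors [d1_splity] term by term. With [jseq_x], multiplication by [jseq p] thus obeys the
    letter recursion of [Jop]. *)
Lemma jseq_y s p a m :
  jseq p m * yseq s a m
  = yseq s (fun i => jseq p i * a i) m + yseq s (fun i => p i * yseq 1 a i) m
    - xseq (fun i => p i * yseq s a i) m - yseq s (fun i => p i * yseq s a i) m.
Proof.
rewrite -yseqD.
have -> : jseq p m * yseq s a m = - (m%:R^-1 * (s * (jseq p m * gsum s (psum a) m))).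
  by rewrite /yseq; ring.
rewrite jseq_gsum /yseq /xseq.
have -> : psum (fun i => jseq p i * a i + p i * yseq 1 a i) =
          (fun i => jseq p i * psum a i).
  by apply/funext => i; rewrite jseq_psum.
by rewrite /yseq; ring.
Qed.

End Sequences.

(** * Sequences attached to words *)

Section WordSequences.
Variables (K : numFieldType) (r : nat) (hr : (0 < r)%N) (z : K).
Local Notation A := {freeg (word r) / K}.

Fixpoint csum (s : K) (a : nat -> K) (m : nat) : K :=
  if m is m'.+1 then s * (csum s a m' + a m') else 0.

(** The part of the series of [w] with outermost index [m], that is, the coefficient of [t^m] in the
    iterated integral; the delta at 0 stands for the constant 1. *)
Fixpoint wcoef (w : word r) : nat -> K :=
  match w with
  | [::] => fun m => (m == 0%N)%:R
  | None :: w' => fun m => m%:R^-1 * wcoef w' m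
  | Some j :: w' => fun m => m%:R^-1 * csum (z ^+ j) (wcoef w') m
  end.

Fixpoint wseq (w : word r) : nat -> K :=
  match w with
  | [::] => fun m => (m == 0%N)%:R
  | None :: w' => xseq (wseq w')
  | Some j :: w' => yseq (z ^+ j) (wseq w')
  end.

(** The default [None] excludes the empty word. *)
Definition yend (w : word r) : bool := isSome (last None w).

Lemma yend_cons u w : yend (u :: w) = if w is [::] then isSome u else yend w.
Proof. by case: w. Qed.

Lemma wcoef0 w : w != [::] -> wcoef w 0 = 0.
Proof. by case: w => [//|[j|] w] _ /=; rewrite invr0 mul0r. Qed.

Lemma wseq0 w : w != [::] -> wseq w 0 = 0.
Proof.
case: w => [//|[j|] w] _ /=; rewrite /xseq /yseq invr0 ?mul0r //.
by rewrite mulr0 oppr0.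
Qed.

Lemma btrans_x (a b : nat -> K) : a 0 = 0 -> psum b =1 btrans a ->
  psum (fun m => m%:R^-1 * b m) =1 btrans (xseq a).
Proof.
move=> a0 Hb n; elim: n => [|n IH].
  by rewrite psum0 btrans0 /xseq invr0 !mul0r.
rewrite psumS IH (@btrans_divn _ (psum a)) ?psum0 //.
by rewrite btrans_psum -!Hb psumS addrAC subrr add0r.
Qed.

Lemma btrans_y s (a b : nat -> K) : psum b =1 btrans a ->
  psum (fun m => m%:R^-1 * csum s b m) =1 btrans (yseq s a).
Proof.
move=> Hb n; have Hpsum k : btrans (psum a) k = b k.
  case: k => [|k]; first by rewrite btrans0 psum0 -(btrans0 a) -Hb psum0.
  by rewrite btrans_psum -!Hb psumS addrAC subrr add0r.
(* Under the transform, [- s * gsum] satisfies the recursion defining [csum]. *)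
have Hc k : btrans (fun m => - s * gsum s (psum a) m) k = csum s b k.
  elim: k => [|k IH]; first by rewrite btrans0 /= mulr0.
  rewrite btransZ btrans_gsum Hpsum /= -IH btransZ; ring.
elim: n => [|n IH].
  by rewrite psum0 btrans0 /yseq /= !mulr0 oppr0.
rewrite psumS IH (@btrans_divn _ (fun m => - s * gsum s (psum a) m)) ?Hc //=.
  by move=> m; rewrite /yseq /=; ring.
by rewrite mulr0.
Qed.

(** Induction on the first letter. Prepending x requires the value 0 at index 0 ([btrans_x]), which
    fails only for the empty word; hence the condition on the last letter. *)
Lemma psum_wcoef w : (w == [::]) || yend w -> psum (wcoef w) =1 btrans (wseq w).
Proof.
elim: w => [_ n|u w IH]; last rewrite orFb yend_cons => Hw.
  rewrite (@eq_btrans _ _ (fun m => if m == 0%N then 1 else 0)); last by case.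
  rewrite btrans_delta; elim: n => [|n IH]; first by rewrite psum0.
  by rewrite psumS IH /= addr0.
have Hb : psum (wcoef w) =1 btrans (wseq w) by apply: IH; case: (w) Hw.
case: u Hw => [j|] /= Hw; first exact: btrans_y.
by apply: btrans_x => //; apply: wseq0; case: (w) Hw.
Qed.

Definition rho (g : A) (m : nat) : K := fglift (fun w => wseq w m : K^o) g.

Lemma rhoD g h m : rho (g + h) m = rho g m + rho h m.
Proof. exact: (linearD (fglift (fun w => wseq w m : K^o))). Qed.

Lemma rhoN g m : rho (- g) m = - rho g m.
Proof. exact: (linearN (fglift (fun w => wseq w m : K^o))). Qed.

Lemma rhoZ c g m : rho (c *: g) m = c * rho g m.
Proof. by rewrite /rho linearZ. Qed.

Lemma rho0 m : rho 0 m = 0.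
Proof. exact: (linear0 (fglift (fun w => wseq w m : K^o))). Qed.

Lemma rhoU w m : rho << w >> m = wseq w m.
Proof. by rewrite /rho liftU1. Qed.

Definition letter_seq (u : letter r) : (nat -> K) -> nat -> K :=
  if u is Some j then @yseq K (z ^+ j) else @xseq K.

Lemma rho_lmul u (g : A) m : rho (lmul u g) m = letter_seq u (rho g) m.
Proof.
have lsZD c a b k : letter_seq u (fun i => c * a i + b i) k =
    c * letter_seq u a k + letter_seq u b k.
  by case: (u) => [j|] /=; rewrite ?xseqD ?xseqZ ?yseqD ?yseqZ.
elim/freeg_lin_ind: g => [|c g h Hg Hh|w].
- rewrite lmul0 rho0 (_ : rho 0 = fun i => -1 * rho 0 i + rho 0 i).
    by rewrite lsZD mulN1r addNr.
  by apply/funext => i; rewrite mulN1r addNr rho0.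
- rewrite lmulD lmulZ rhoD rhoZ Hg Hh -lsZD; congr (letter_seq u _ m).
  by apply/funext => i; rewrite rhoD rhoZ.
- rewrite lmulU rhoU (_ : rho << w >> = wseq w); last by apply/funext => i; rewrite rhoU.
  by case: u {lsZD}.
Qed.

Fixpoint opseq (e : op K) : nat -> K :=
  match e with
  | Iop => fun=> 1
  | Zop e => fun m => m%:R^-1 * opseq e m
  | Jop e => jseq (opseq e)
  | Aop e f => fun m => opseq e m + opseq f m
  | Sop k e => fun m => k * opseq e m
  end.

(** The letter recursions agree by [zseqE], [jseq_x] and [jseq_y]. On the empty word, whose sequence
    is the delta at 0, [Jop] gives 0 and so does [jseq], because [jseq _ 0 = 0]. *)
Lemma rho_op e g m : rho (opA hr e g) m = opseq e m * rho g m.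
Proof.
elim: e g m => [|e IH|e IH|e IHe f IHf|k e IH] g m; rewrite ?opAE.
- by rewrite mul1r.
- rewrite zmulE rhoD !rho_lmul /= expr0 zseqE IH; ring.
- elim/lmul_ind: g m => [|c g h Hg Hh||u g Hg] m.
  + by rewrite opA0 !rho0 mulr0.
  + by rewrite opAD opAZ !rhoD !rhoZ Hg Hh; ring.
  + rewrite opA_J1 rho0 rhoU; case: m => [|m] /=; last by rewrite mulr0.
    by rewrite jseq0 mul0r.
  + have Hu v : rho (opA hr e (lmul v g)) = fun i => opseq e i * letter_seq v (rho g) i.
      by apply/funext => i; rewrite IH rho_lmul.
    have HJ : rho (opA hr (Jop e) g) = fun i => jseq (opseq e) i * rho g i.
      by apply/funext => i; rewrite Hg.
    rewrite opA_J; case: u => [j|]; rewrite d1_splitE !(rhoD, rhoN) !rho_lmul.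
      by rewrite !Hu HJ /= expr0 jseq_y; ring.
    by rewrite !Hu HJ /= expr0 jseq_x.
- by rewrite rhoD IHe IHf /=; ring.
- by rewrite rhoZ IH /=; ring.
Qed.

End WordSequences.

(** * Partial sums of the defining series *)

Section PartialSums.
Variables (R : realType) (r : nat).
Local Notation z := (zeta r R).

Lemma csumE s (a : nat -> R[i]) m :
  csum s a m = \sum_(0 <= i < m) s ^+ (m - i) * a i.
Proof.
elim: m => [|m IH]; first by rewrite big_geq.
rewrite big_nat_recr //= IH subSnn expr1 mulrDr; congr (_ + _).
rewrite big_distrr /=; apply: eq_big_nat => i /andP[_ im].
by rewrite subSn ?(ltnW im) // exprS mulrA.
Qed.

(** [cnt] counts the letters x read since the last y_s and [jp] is the exponent of that y_s; the
    induction needs both arbitrary. *)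
Lemma Tsum_widx (w : word r) cnt jp mp : yend w ->
  Tsum R jp mp (widx cnt w) =
  \sum_(1 <= m < mp) z ^+ (jp * (mp - m)) / m%:R ^+ cnt * wcoef z w m.
Proof.
elim: w cnt jp mp => [//|u w IH] cnt jp mp; rewrite yend_cons => Hw.
have dE (m : nat) : (m%:R : R[i]) ^+ cnt.+1 = m%:R ^+ cnt * m%:R by rewrite exprSr.
case: u Hw => [j|] Hw; last first.
  rewrite [widx _ _]/= IH; last by case: (w) Hw.
  by apply: eq_bigr => m _; rewrite dE invfM /= -!mulrA.
rewrite [LHS]/=; apply: eq_big_nat => m /andP[m0 _].
rewrite dE invfM /= -!mulrA; congr (_ * (_ * (_ * _))).
(* If no letter follows, the delta leaves only index 0, which yields [s^m]; otherwise index 0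
   contributes nothing. *)
rewrite csumE; case: w IH Hw => [|v w] IH Hw.
  case: m m0 => [//|m] _ /=; rewrite big_nat_recl // big1 => [|i _]; last by rewrite mulr0.
  by rewrite subn0 mulr1 exprM addr0.
rewrite IH //; case: m m0 => [//|m] _.
rewrite [in RHS]big_ltn // wcoef0 // mulr0 add0r.
by apply: eq_bigr => i _; rewrite exprM expr0 divr1.
Qed.

(** [M > m_1] is strict, so truncation at [n.+1] keeps the indices up to [n]. *)
Lemma partial_sumE (w : word r) n : yend w ->
  partial_sum R w n.+1 = psum (wcoef z w) n.
Proof.
move=> Hw; rewrite /partial_sum Tsum_widx // /psum -(big_mkord xpredT (wcoef z w)).
rewrite [in RHS]big_ltn // wcoef0 ?add0r; last by case: (w) Hw.
by apply: eq_bigr => i _; rewrite mul0n expr0 divr1 mul1r.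
Qed.

End PartialSums.

(** * Norms and harmonic numbers *)

Section ComplexNorm.
Variable R : realType.
Implicit Types a b : R[i].
Local Notation N := (@Normc.normc R).

Lemma normcD a b : N (a + b) <= N a + N b.
Proof. exact: le_normcD. Qed.

Lemma normc_opp a : N (- a) = N a.
Proof. exact: normcN. Qed.

Lemma normc_ge0 a : 0 <= N a.
Proof. by case: a => u v; apply: sqrtr_ge0. Qed.

Lemma normcB a b : N (a - b) <= N a + N b.
Proof. by rewrite -(normc_opp b) normcD. Qed.

Lemma normc_0 : N 0 = 0. Proof. exact: Normc.normc0. Qed.

Lemma normc_1 : N 1 = 1. Proof. exact: Normc.normc1. Qed.

Lemma normc_nat n : N n%:R = n%:R.
Proof. by rewrite -[n%:R]/(1 *+ n) (@normcMn R 1) normc_1. Qed.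

Lemma normc_natV n : N n%:R^-1 = n%:R^-1.
Proof. by rewrite Normc.normcV normc_nat. Qed.

End ComplexNorm.

Section Growth.
Variable R : realType.

(* The summand [1] makes the powers of [hsum n] monotone in the exponent. *)
Fixpoint hsum (n : nat) : R := if n is n'.+1 then hsum n' + n'.+1%:R^-1 else 1.

Lemma hsum_ge1 n : 1 <= hsum n.
Proof.
by elim: n => [//|n IH] /=; rewrite (le_trans IH) // lerDl invr_ge0 ler0n.
Qed.

Lemma hsum_ge0 n : 0 <= hsum n.
Proof. exact: le_trans ler01 (hsum_ge1 n). Qed.

Lemma hsum_mono m n : (m <= n)%N -> hsum m <= hsum n.
Proof.
move=> /subnK <-; elim: (n - m)%N => [//|k IH].
by rewrite addSn /= (le_trans IH) // lerDl invr_ge0 ler0n.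
Qed.

Lemma hsumX_mono d m n : (m <= n)%N -> hsum m ^+ d <= hsum n ^+ d.
Proof. by move=> mn; rewrite lerXn2r ?nnegrE ?hsum_ge0 // hsum_mono. Qed.

Lemma hsumX_ge1 d n : 1 <= hsum n ^+ d.
Proof. by rewrite exprn_ege1 // hsum_ge1. Qed.

Lemma hsumX_ge0 d n : 0 <= hsum n ^+ d.
Proof. exact: le_trans ler01 (hsumX_ge1 d n). Qed.

Lemma hsumX_le d e n : (d <= e)%N -> hsum n ^+ d <= hsum n ^+ e.
Proof. by move=> de; rewrite ler_weXn2l ?hsum_ge1. Qed.

Lemma sum_inv_sub n : \sum_(i < n) (n - i)%:R^-1 = hsum n - 1 :> R.
Proof.
elim: n => [|n IH]; first by rewrite big_ord0 subrr.
rewrite big_ord_recl subn0 /= addrAC -IH addrC; congr (_ + _).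
Qed.

Lemma sum_inv n : \sum_(i < n) i.+1%:R^-1 = hsum n - 1 :> R.
Proof.
elim: n => [|n IH]; first by rewrite big_ord0 subrr.
by rewrite big_ord_recr IH /= addrAC.
Qed.

(** Partial fractions: [1/((i+1)(n-i))] is [(1/(i+1) + 1/(n-i))/(n+1)]. *)
Lemma sum_inv_mul n :
  \sum_(i < n) (i.+1%:R^-1 * (n - i)%:R^-1) = 2 * (hsum n - 1) / n.+1%:R :> R.
Proof.
have -> : 2 * (hsum n - 1) / n.+1%:R =
    (\sum_(i < n) i.+1%:R^-1 + \sum_(i < n) (n - i)%:R^-1) / n.+1%:R :> R.
  by rewrite sum_inv sum_inv_sub; congr (_ / _); ring.
rewrite -big_split mulr_suml; apply: eq_bigr => i _ /=.
have ni : (0 < n - i)%N by rewrite subn_gt0.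
have -> : (n.+1%:R : R) = i.+1%:R + (n - i)%:R.
  by rewrite -natrD addSn subnKC // ltnW.
have p1 : (0 : R) < i.+1%:R by rewrite ltr0n.
have p2 : (0 : R) < (n - i)%:R by rewrite ltr0n.
by field; rewrite nat1r !gt_eqF ?addr_gt0.
Qed.

Lemma expr_le_expR (x : R) d : 0 <= x -> x ^+ d <= d%:R ^+ d * expR x.
Proof.
case: d => [|d] x0; first by rewrite !expr0 mul1r (le_trans _ (expR_ge1Dx x)) ?lerDl.
have d0 : (0 : R) < d.+1%:R by rewrite ltr0n.
have -> : expR x = expR (x / d.+1%:R) ^+ d.+1.
  by rewrite -expRM_natl mulrC divfK ?gt_eqF.
rewrite -exprMn lerXn2r ?nnegrE ?mulr_ge0 ?expR_ge0 ?ler0n //.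
have := expR_ge1Dx (x / d.+1%:R) => h.
rewrite mulrC -ler_pdivrMr //; apply: le_trans h; by rewrite lerDr.
Qed.

Lemma expR_hsum n : expR (hsum n) <= expR 2 * n.+1%:R.
Proof.
have e2 : (0 : R) < expR 2 := expR_gt0 2.
(* The shifted claim is an equality at [k = 0], where [hsum 1 = 2]. The induction step rests on
   [1 - x <= exp(-x)] with [x = 1/(k+2)]. *)
suff H k : expR (hsum k.+1) <= expR 2 * k.+1%:R.
  case: n => [|n]; first by rewrite mulr1 ler_expR /= ler1n.
  by rewrite (le_trans (H n)) // ler_pM2l // ler_nat.
elim: k => [|k IH]; first by rewrite mulr1 /= invr1.
rewrite [hsum _]/= -/(hsum k.+1) expRD.
have Hk : expR (k.+2%:R^-1) <= k.+2%:R / k.+1%:R :> R.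
  have E : k.+2%:R / k.+1%:R = (1 - k.+2%:R^-1)^-1 :> R.
    field; have -> : 2 + k%:R - 1 = k.+1%:R :> R by rewrite -nat1r; ring.
    by rewrite -natrD !pnatr_eq0.
  rewrite E -[expR _]invrK -expRN lef_pV2 ?posrE ?expR_gt0 ?expR_ge1Dx //.
  by rewrite subr_gt0 invf_lt1 ?ltr0n // ltr1n.
apply: le_trans (ler_pM (expR_ge0 _) (expR_ge0 _) IH Hk) _.
by rewrite mulrA mulrAC mulfK ?pnatr_eq0.
Qed.

Lemma hsumX_bound d : exists2 C : R, 0 < C & forall n, hsum n ^+ d <= C * n.+1%:R.
Proof.
exists (d.+1%:R ^+ d.+1 * expR 2) => [|n].
  by rewrite mulr_gt0 ?exprn_gt0 ?ltr0n ?expR_gt0.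
apply: le_trans (hsumX_le n (leqnSn d)) _.
apply: le_trans (expr_le_expR _ (hsum_ge0 n)) _.
by rewrite -mulrA ler_pM2l ?expR_hsum // exprn_gt0 ?ltr0n.
Qed.

Lemma hsumX_sqrt d :
  exists2 C : R, 0 < C & forall n, hsum n ^+ d <= C * Num.sqrt n.+1%:R.
Proof.
have [C C0 H] := hsumX_bound (d * 2); exists (Num.sqrt C) => [|n].
  by rewrite sqrtr_gt0.
rewrite -sqrtrM ?(ltW C0) // -[leLHS]ger0_norm ?hsumX_ge0 // -sqrtr_sqr.
by rewrite ler_wsqrtr // -exprM.
Qed.

End Growth.

(** * Multipliers *)

Section Multipliers.
Variable R : realType.
Local Notation K := R[i].
Local Notation N := (@Normc.normc R).
Local Notation h := (@hsum R).
Implicit Types (a p : nat -> K).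

(** Multiplication by [p] is measured on transforms: it costs at most a power of the logarithm. The
    condition [a 0 = 0] makes division by [m] compatible with [btrans_divn]. *)
Definition multiplier p (C : R) (d : nat) : Prop :=
  0 <= C /\ forall a n (b : R), a 0 = 0 -> (forall j, (j <= n)%N -> N (btrans a j) <= b) ->
    N (btrans (fun m => p m * a m) n) <= C * h n ^+ d * b.

Lemma multiplier_weak p C d e : (d <= e)%N -> multiplier p C d -> multiplier p C e.
Proof.
move=> de [C0 H]; split=> // a n b a0 Hb; apply: le_trans (H a n b a0 Hb) _.
have b0 : 0 <= b by apply: le_trans (Hb 0%N isT); apply: normc_ge0.
by rewrite ler_wpM2r // ler_wpM2l // hsumX_le.
Qed.

Lemma multiplier_div p C d : multiplier p C d ->
  multiplier (fun m => m%:R^-1 * p m) C d.+1.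
Proof.
move=> [C0 H]; split=> // a n b a0 Hb.
have b0 : 0 <= b by apply: le_trans (Hb 0%N isT); apply: normc_ge0.
have Ch0 : 0 <= C * h n ^+ d * b by rewrite !mulr_ge0 ?hsumX_ge0.
(* Division by [m] accumulates one term of weight [1/j] per index [j]; [h k - 1] is the sum of these
   weights. *)
suff Hk k : (k <= n)%N ->
    N (btrans (fun m => m%:R^-1 * p m * a m) k) <= C * h n ^+ d * b * (h k - 1).
  apply: le_trans (Hk n (leqnn n)) _; rewrite exprSr mulrA [leRHS]mulrAC.
  by rewrite ler_wpM2l // gerBl.
elim: k => [|k IH] kn; first by rewrite btrans0 a0 mulr0 normc_0 subrr mulr0.
rewrite (@btrans_divn _ (fun m => p m * a m)); last 2 first.
- by move=> m; rewrite mulrA.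
- by rewrite a0 mulr0.
apply: le_trans (normcD _ _) _.
rewrite [leRHS](_ : _ = C * h n ^+ d * b * (h k - 1) + C * h n ^+ d * b * k.+1%:R^-1);
  last by rewrite /=; ring.
apply: lerD; first exact: IH (ltnW kn).
rewrite Normc.normcM normc_natV mulrC ler_wpM2r ?invr_ge0 ?ler0n //.
apply: le_trans (H a k.+1 b a0 _) _ => [j jk|]; first exact: Hb (leq_trans jk kn).
by rewrite ler_wpM2r // ler_wpM2l // hsumX_mono.
Qed.

Lemma multiplier1 : multiplier (fun=> 1) 1 0.
Proof.
split=> // a n b _ Hb; rewrite expr0 !mul1r.
by rewrite (eq_btrans _ (b := a)) ?Hb // => m; rewrite mul1r.
Qed.

Lemma multiplierD p q C D d : multiplier p C d -> multiplier q D d ->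
  multiplier (fun m => p m + q m) (C + D) d.
Proof.
move=> [C0 Hp] [D0 Hq]; split=> [|a n b a0 Hb]; first exact: addr_ge0.
rewrite (eq_btrans _ (b := fun m => p m * a m + q m * a m)); last first.
  by move=> m; rewrite mulrDl.
rewrite btransD !mulrDl; apply: le_trans (normcD _ _) _.
by apply: lerD; [apply: Hp|apply: Hq].
Qed.

Lemma multiplierZ k p C d : multiplier p C d -> multiplier (fun m => k * p m) (N k * C) d.
Proof.
move=> [C0 Hp]; split=> [|a n b a0 Hb]; first exact: mulr_ge0 (normc_ge0 _) C0.
rewrite (eq_btrans _ (b := fun m => k * (p m * a m))); last first.
  by move=> m; rewrite mulrA.
by rewrite btransZ Normc.normcM -!mulrA ler_wpM2l ?normc_ge0 // mulrA Hp.
Qed.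

(** Discrete Leibniz rule: the difference of [jseq p * a] is [jseq p] times the difference of [a],
    plus the shift of [p * a / m]. The shift never sees index 0, so [a] may be replaced there by
    [a'], which vanishes at 0 as [multiplier] demands. *)
Lemma btrans_jseqS p a n (a' := fun m => if m == 0%N then 0 else a m) :
  btrans (fun m => jseq p m * a m) n.+1 =
  btrans (fun m => jseq p m * bdiff a m) n
  - n.+1%:R^-1 * btrans (fun m => p m * a' m) n.+1.
Proof.
pose t m := m%:R^-1 * (p m * a' m).
have -> : btrans (fun m => jseq p m * a m) n.+1 =
    btrans (fun m => jseq p m * bdiff a m) n + btrans (fun m => t m.+1) n.
  rewrite btransS -btransD; apply: eq_btrans => m.
  by rewrite /bdiff jseqS /t /a' /=; ring.
rewrite btrans_shift (@btrans_divn _ (fun m => p m * a' m) t) /a' //=; last by rewrite mulr0.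
ring.
Qed.

Lemma btrans_delete0 a n (a' := fun m => if m == 0%N then 0 else a m) :
  btrans a' n = btrans a n - a 0.
Proof.
have -> : btrans a n = btrans (fun m => a' m + (if m == 0%N then a 0 else 0)) n.
  by apply: eq_btrans => -[|m]; rewrite /a' /= ?add0r ?addr0.
by rewrite btransD btrans_delta addrK.
Qed.

(** Unrolls [btrans_jseqS]: step [i] acts on the [i]-th difference of [a], whose transform is that
    of [a] shifted by [i]. The factor 2 pays for deleting the value at 0, and [m] stays fixed while
    [n] decreases so that the logarithmic factor is uniform. *)
Lemma btrans_jseq_le p C d a n m (b : nat -> R) : multiplier p C d -> (n <= m)%N ->
  (forall i j, (i <= j <= n)%N -> N (btrans a j) <= b i) ->
  N (btrans (fun k => jseq p k * a k) n) <=
  \sum_(i < n) 2 * C * h m ^+ d * b i / (n - i)%:R.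
Proof.
move=> [C0 H]; elim: n a b => [|n IH] a b nm Hb.
  by rewrite btrans0 jseq0 mul0r normc_0 big_ord0.
rewrite btrans_jseqS; apply: le_trans (normcB _ _) _.
rewrite big_ord_recl subn0 addrC; apply: lerD.
  have b0 : 0 <= b 0%N by apply: le_trans (Hb 0%N 0%N isT); apply: normc_ge0.
  rewrite Normc.normcM normc_natV mulrC ler_wpM2r ?invr_ge0 ?ler0n //.
  apply: le_trans (H _ n.+1 (2 * b 0%N) _ _) _ => // [j jn|].
    rewrite btrans_delete0; apply: le_trans (normcB _ _) _.
    by rewrite -[a 0]btrans0 mulr_natl mulr2n lerD ?Hb.
  rewrite [leLHS](_ : _ = 2 * C * b 0%N * h n.+1 ^+ d); last by ring.
  rewrite [leRHS](_ : _ = 2 * C * b 0%N * h m ^+ d); last by ring.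
  by rewrite ler_wpM2l ?hsumX_mono // !mulr_ge0.
apply: le_trans (IH (bdiff a) (fun i => b i.+1) (ltnW nm) _) _ => [i j ij|].
  by rewrite -btransS Hb.
by apply: ler_sum => i _; rewrite lift0 subSS.
Qed.

Lemma multiplierJ p C d : multiplier p C d -> multiplier (jseq p) (2 * C) d.+1.
Proof.
move=> Hp; have [C0 _] := Hp; split=> [|a n b a0 Hb]; first by rewrite mulr_ge0.
have b0 : 0 <= b by apply: le_trans (Hb 0%N isT); apply: normc_ge0.
apply: le_trans (btrans_jseq_le (b := fun=> b) Hp (leqnn n) _) _ => [i j /andP[_]|].
  exact: Hb.
rewrite -mulr_sumr sum_inv_sub exprSr mulrA [leRHS]mulrAC ler_wpM2l ?gerBl //.
by rewrite !mulr_ge0 ?hsumX_ge0.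
Qed.

Lemma opseq_multiplier (e : op K) : exists C d, multiplier (opseq e) C d.
Proof.
elim: e => [|e [C [d H]]|e [C [d H]]|e [C [d H]] f [D [d' H']]|k e [C [d H]]].
- by exists 1, 0%N; apply: multiplier1.
- by exists C, d.+1; apply: multiplier_div.
- by exists (2 * C), d.+1; apply: multiplierJ.
- exists (C + D), (maxn d d'); apply: multiplierD.
    exact: multiplier_weak (leq_maxl _ _) H.
  exact: multiplier_weak (leq_maxr _ _) H'.
- by exists (N k * C), d; apply: multiplierZ.
Qed.

(** In the convolution of [1/sqrt(i+1)] with [1/(n-i)], write [1/sqrt(i+1) <= sqrt(n+1)/(i+1)] and
    apply [sum_inv_mul]: the decay in [1/sqrt(n+1)] survives up to one more logarithm. *)
Lemma btrans_jseq_decay p C d a (D : R) : multiplier p C d ->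
  (forall n, N (btrans a n) <= D / Num.sqrt n.+1%:R) ->
  forall n, N (btrans (fun k => jseq p k * a k) n) <=
            4 * C * D * h n ^+ d.+1 / Num.sqrt n.+1%:R.
Proof.
move=> Hp HD n; have [C0 _] := Hp.
have sq_gt0 (i : nat) : (0 : R) < Num.sqrt i.+1%:R by rewrite sqrtr_gt0 ltr0n.
have D0 : 0 <= D.
  by have := le_trans (normc_ge0 _) (HD 0%N); rewrite sqrtr1 divr1.
apply: le_trans (btrans_jseq_le (b := fun i => D / Num.sqrt i.+1%:R) Hp (leqnn n) _) _.
  move=> i j /andP[ij _]; apply: le_trans (HD j) _; rewrite ler_wpM2l //.
  by rewrite lef_pV2 ?posrE // ler_wsqrtr // ler_nat.
apply: (@le_trans _ _ (\sum_(i < n) 2 * C * h n ^+ d * D * Num.sqrt n.+1%:R *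
                         (i.+1%:R^-1 * (n - i)%:R^-1))).
  apply: ler_sum => i _; rewrite !mulrA ler_wpM2r ?invr_ge0 ?ler0n // -!mulrA.
  do 4 (rewrite ler_wpM2l ?hsumX_ge0 //).
  have s0 := sq_gt0 i; set s := Num.sqrt i.+1%:R in s0 *.
  have -> : (i.+1%:R : R) = s * s by rewrite -expr2 sqr_sqrtr ?ler0n.
  rewrite invfM mulrA ler_pMl ?invr_gt0 // ler_pdivlMr // mul1r.
  by rewrite ler_wsqrtr // ler_nat ltnW // ltnS.
rewrite -mulr_sumr sum_inv_mul.
have s0 := sq_gt0 n; set s := Num.sqrt n.+1%:R in s0 *.
have -> : (n.+1%:R : R) = s * s by rewrite -expr2 sqr_sqrtr ?ler0n.
rewrite [leLHS](_ : _ = 4 * C * D * h n ^+ d * (h n - 1) / s); last first.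
  by field; rewrite gt_eqF.
rewrite ler_wpM2r ?invr_ge0 ?(ltW s0) // exprSr [leRHS]mulrA ler_wpM2l ?gerBl //.
by rewrite !mulr_ge0 ?hsumX_ge0.
Qed.

End Multipliers.

(** * Convergence of admissible words *)

Section Convergence.
Variables (R : realType) (r : nat).
Local Notation K := R[i].
Local Notation N := (@Normc.normc R).
Local Notation h := (@hsum R).
Local Notation z := (zeta r R).
Local Notation A := {freeg (word r) / K}.

Lemma zeta_exp j :
  z ^+ j = Complex (cos (2 * pi / r%:R *+ j)) (sin (2 * pi / r%:R *+ j)).
Proof.
rewrite /zeta; set t := 2 * pi / r%:R.
elim: j => [|j IH]; first by rewrite expr0 mulr0n cos0 sin0.
rewrite exprS IH mulrS cosD sinD; simpc.
by congr Complex; rewrite addrC.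
Qed.

Lemma normc_zeta j : N (z ^+ j) = 1.
Proof. by rewrite zeta_exp /= cos2Dsin2 sqrtr1. Qed.

Lemma zeta_neq1 (j : 'I_r) : nat_of_ord j != 0%N -> z ^+ j != 1.
Proof.
move=> j0; apply/negP; rewrite zeta_exp => /eqP [] + _.
have r0 : (0 : R) < r%:R by rewrite ltr0n (leq_ltn_trans (leq0n j)) ?ltn_ord.
set x : R := pi / r%:R * j%:R.
have -> : 2 * pi / r%:R *+ j = x *+ 2 :> R.
  by rewrite -[LHS]mulr_natr -[RHS]mulr_natr /x; ring.
rewrite cos_mulr2n => c1.
have x0 : 0 < sin x.
  apply: sin_gt0_pi; rewrite /x; apply/andP; split.
    by rewrite !mulr_gt0 ?invr_gt0 ?pi_gt0 // ltr0n lt0n.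
  by rewrite mulrAC ltr_pdivrMr // ltr_pM2l ?pi_gt0 // ltr_nat.
have := cos2Dsin2 x; have : 0 < sin x ^+ 2 by rewrite exprn_gt0.
lra.
Qed.

Lemma sqrt_gt0 n : (0 : R) < Num.sqrt n.+1%:R.
Proof. by rewrite sqrtr_gt0 ltr0n. Qed.

Lemma sqrt_sqr n : Num.sqrt n%:R * Num.sqrt n%:R = n%:R :> R.
Proof. by rewrite -expr2 sqr_sqrtr ?ler0n. Qed.

Lemma sqrt_le m n : (m <= n)%N -> Num.sqrt m%:R <= Num.sqrt n%:R :> R.
Proof. by move=> mn; rewrite ler_wsqrtr // ler_nat. Qed.

(** With [a], [b] the two roots, multiplying by [a + b] replaces [b - a] by 1 and leaves
    [b (a + b) <= 6 a^2], which follows from [b <= 2 a]; hence the constant 6. *)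
Lemma inv_sqrt_telescope j :
  (j.+1%:R * Num.sqrt j.+1%:R)^-1 <=
  6 * ((Num.sqrt j.+1%:R)^-1 - (Num.sqrt j.+2%:R)^-1) :> R.
Proof.
have a0 := sqrt_gt0 j; have b0 := sqrt_gt0 j.+1.
have aa := sqrt_sqr j.+1; have bb := sqrt_sqr j.+2.
set a := Num.sqrt j.+1%:R in a0 aa *; set b := Num.sqrt j.+2%:R in b0 bb *.
have ab : b * b = a * a + 1 by rewrite aa bb -[j.+2%:R]natr1.
have a1 : 1 <= a * a by rewrite aa ler1n.
have b2a : b <= 2 * a.
  by rewrite -(@ler_pXn2r _ 2) ?nnegrE ?mulr_ge0 ?ltW // !expr2; nra.
rewrite -aa -subr_ge0.
have -> : 6 * (a^-1 - b^-1) - (a * a * a)^-1 =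
    (6 * (a * a) * (b - a) - b) / (a * a * a * b).
  by field; rewrite !gt_eqF.
rewrite divr_ge0 ?mulr_ge0 ?(ltW a0) ?(ltW b0) //.
have ba : 0 < a + b by exact: addr_gt0.
rewrite -(pmulr_rge0 _ ba).
have -> : (a + b) * (6 * (a * a) * (b - a) - b) = 6 * (a * a) - b * (a + b).
  have -> : (a + b) * (6 * (a * a) * (b - a) - b) =
    6 * (a * a) * (b * b - a * a) - b * (a + b) by ring.
  by rewrite ab; ring.
nra.
Qed.

Lemma tail_bound (E : nat -> K) (C : R) : 0 <= C ->
  (forall j, N (E j.+1 - E j) <= C / (j.+1%:R * Num.sqrt j.+1%:R)) ->
  forall n m, (n <= m)%N -> N (E m - E n) <= 6 * C / Num.sqrt n.+1%:R.
Proof.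
move=> C0 HE n m nm.
suff H k : N (E (n + k)%N - E n) <=
    6 * C * ((Num.sqrt n.+1%:R)^-1 - (Num.sqrt (n + k).+1%:R)^-1).
  have := H (m - n)%N; rewrite subnKC // => /le_trans; apply.
  by rewrite ler_wpM2l ?mulr_ge0 // gerBl invr_ge0 ltW ?sqrt_gt0.
elim: k => [|k IH]; first by rewrite addn0 !subrr mulr0 normc_0.
rewrite addnS; have -> : E (n + k).+1 - E n =
  (E (n + k).+1 - E (n + k)%N) + (E (n + k)%N - E n) by ring.
apply: le_trans (normcD _ _) _; apply: le_trans (lerD (HE _) IH) _.
rewrite -lerBrDr; apply: le_trans (ler_wpM2l C0 (inv_sqrt_telescope (n + k))) _.
by rewrite -subr_ge0 [leRHS](_ : _ = 0) //; ring.
Qed.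

Lemma hsumX_sqrtS d :
  exists2 C : R, 0 < C & forall j, h j.+1 ^+ d <= C * Num.sqrt j.+1%:R.
Proof.
have [C C0 H] := hsumX_sqrt R d; exists (C * 2) => [|j]; first exact: mulr_gt0.
apply: le_trans (H j.+1) _; rewrite -mulrA ler_pM2l //.
have -> : 2 = Num.sqrt (2 ^+ 2) :> R by rewrite sqrtr_sqr ger0_norm.
rewrite -sqrtrM ?exprn_ge0 // ler_wsqrtr // expr2.
by rewrite -[j.+2%:R]natr1 -[j.+1%:R]natr1; have := ler0n R j; lra.
Qed.

Lemma csum_bound s (a : nat -> K) d : N s = 1 -> a 0 = 0 ->
  (forall k, N (a k.+1) <= h k.+1 ^+ d / k.+1%:R) ->
  forall k, N (csum s a k) <= h k ^+ d.+1.
Proof.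
move=> s1 a0 Ha.
have H k : N (csum s a k.+1) <= h k ^+ d * (h k - 1).
  elim: k => [|k IH].
    by rewrite /= a0 addr0 mulr0 normc_0 subrr mulr0.
  have -> : csum s a k.+2 = s * (csum s a k.+1 + a k.+1) by [].
  rewrite Normc.normcM s1 mul1r; apply: le_trans (normcD _ _) _.
  apply: le_trans (lerD IH (Ha k)) _.
  have -> : h k.+1 ^+ d * (h k.+1 - 1) =
    h k.+1 ^+ d * (h k - 1) + h k.+1 ^+ d / k.+1%:R by rewrite /=; ring.
  by rewrite lerD2r ler_wpM2r ?subr_ge0 ?hsum_ge1 // hsumX_mono.
case=> [|k]; first by rewrite normc_0 hsumX_ge0.
apply: le_trans (H k) _; apply: (@le_trans _ _ (h k ^+ d.+1)).
  by rewrite exprSr ler_wpM2l ?hsumX_ge0 // gerBl.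
exact: hsumX_mono.
Qed.

Lemma csum_delta s k : csum s (fun m => (m == 0%N)%:R : K) k.+1 = s ^+ k.+1.
Proof.
elim: k => [|k IH]; first by rewrite /= add0r mulr1.
have -> : csum s (fun m => (m == 0%N)%:R) k.+2 =
  s * (csum s (fun m => (m == 0%N)%:R) k.+1 + 0) by [].
by rewrite IH addr0 -exprS.
Qed.

Lemma wcoef_bound (w : word r) k : w != [::] ->
  N (wcoef z w k.+1) <= h k.+1 ^+ size w / k.+1%:R.
Proof.
elim: w k => [//|u w IH] k _.
have k0 : (0 : R) <= k.+1%:R^-1 by rewrite invr_ge0 ler0n.
case: u => [j|].
  have -> : wcoef z (Some j :: w) k.+1 = k.+1%:R^-1 * csum (z ^+ j) (wcoef z w) k.+1 by [].
  rewrite Normc.normcM normc_natV mulrC ler_wpM2r //.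
  case: w IH => [_|v w IH]; first by rewrite csum_delta -exprM normc_zeta hsumX_ge1.
  apply: csum_bound => [||i]; [exact: normc_zeta|exact: wcoef0|exact: IH].
have -> : wcoef z (None :: w) k.+1 = k.+1%:R^-1 * wcoef z w k.+1 by [].
rewrite Normc.normcM normc_natV mulrC ler_wpM2r //.
case: w IH => [_|v w IH]; first by rewrite normc_0 hsumX_ge0.
apply: le_trans (IH k isT) _; rewrite -[leRHS]mulr1; apply: ler_pM => //.
- exact: hsumX_ge0.
- exact: hsumX_le.
- by rewrite invf_le1 ?ltr0n // ler1n.
Qed.

(** The nonempty admissible words ([adm_wordE]); asking [yend] of the tail forces length at least
    2. *)
Definition convergent_word (w : word r) : bool :=
  if w is u :: w' then
    yend w' && (if u is Some t then nat_of_ord t != 0%N else true)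
  else false.

(** After a first letter x the summands are a power of the logarithm over [k^2]. After y_s with
    [s != 1] they are only of order [1/k] up to logarithms, and the oscillation of [s^k] is
    exploited by summation by parts. *)
Lemma psum_wcoef_cauchy w : convergent_word w ->
  exists2 C : R, 0 <= C & forall n m, (n <= m)%N ->
    N (psum (wcoef z w) m - psum (wcoef z w) n) <= C / Num.sqrt n.+1%:R.
Proof.
case: w => [//|u w] /andP[Hw Hu].
have w0 : w != [::] by case: (w) Hw.
have wb := wcoef_bound _ w0; set d := size w in wb.
have [C C0 HC] := hsumX_sqrtS d.
have ab k : N (wcoef z w k.+1) / k.+1%:R <= C / (k.+1%:R * Num.sqrt k.+1%:R).
  apply: (@le_trans _ _ (C * Num.sqrt k.+1%:R / k.+1%:R / k.+1%:R)).
    rewrite ler_wpM2r ?invr_ge0 ?ler0n //; apply: le_trans (wb k) _.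
    by rewrite ler_wpM2r ?invr_ge0 ?ler0n.
  have s0 := sqrt_gt0 k; have := sqrt_sqr k.+1; set t := Num.sqrt k.+1%:R in s0 * => <-.
  rewrite (_ : _ / _ / _ = C / (t * t * t)) //; by field; rewrite gt_eqF.
case: u Hu => [j /= j0|_]; last first.
  exists (6 * C) => [|n m nm]; first by rewrite mulr_ge0 ?ltW.
  apply: tail_bound nm; first exact: ltW.
  move=> k; rewrite psumS addrAC subrr add0r /= Normc.normcM normc_natV mulrC.
  exact: ab.
have s1 := normc_zeta j; have sn1 := zeta_neq1 j0; set s := z ^+ j in s1 sn1.
have cb := csum_bound s1 (wcoef0 z w0) wb.
have [D D0 HD] := hsumX_sqrtS d.+1.
pose c := csum s (wcoef z w).
(* Partial sums corrected by the boundary term of the summation by parts; since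
   [c k.+2 = s * (c k.+1 + wcoef z w k.+1)], the increments of [E] gain a factor [1/k]. *)
pose E k := psum (wcoef z (Some j :: w)) k - c k.+1 / (k.+1%:R * (s - 1)).
have sn0 : s - 1 != 0 by rewrite subr_eq0.
have n0 : 0 < N (s - 1).
  by rewrite lt_def normc_ge0 andbT; apply: contra sn0 => /eqP/Normc.eq0_normc ->.
pose F := (C + D) / N (s - 1).
have F0 : 0 <= F by rewrite divr_ge0 ?addr_ge0 ?ltW.
have HE k : N (E k.+1 - E k) <= F / (k.+1%:R * Num.sqrt k.+1%:R).
  have -> : E k.+1 - E k =
      (c k.+2 * (k.+1%:R^-1 * k.+2%:R^-1) - s * (wcoef z w k.+1 * k.+1%:R^-1)) * (s - 1)^-1.
    rewrite /E psumS.
    have -> : wcoef z (Some j :: w) k.+1 = k.+1%:R^-1 * c k.+1 by [].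
    have -> : c k.+2 = s * (c k.+1 + wcoef z w k.+1) by [].
    have k1 : (k.+1%:R : K) != 0 by rewrite pnatr_eq0.
    have k2 : (k.+2%:R : K) != 0 by rewrite pnatr_eq0.
    have k12 : (k.+2%:R : K) = k.+1%:R + 1 by rewrite natr1.
    move: (c k.+1) (wcoef z w k.+1) (psum _ _) => c1 a1 p1.
    rewrite k12 in k2 *; move: (k.+1%:R : K) k1 k2 => q q0 q1.
    by field; rewrite q0 q1 sn0.
  rewrite Normc.normcM Normc.normcV /F [leRHS]mulrAC ler_wpM2r ?invr_ge0 ?normc_ge0 //.
  apply: le_trans (normcB _ _) _; rewrite addrC mulrDl lerD //.
    by rewrite !Normc.normcM s1 mul1r normc_natV.
  rewrite Normc.normcM (Normc.normcM k.+1%:R^-1) !normc_natV.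
  apply: (@le_trans _ _ (D * Num.sqrt k.+2%:R * (k.+1%:R^-1 * k.+2%:R^-1))).
    rewrite ler_wpM2r ?mulr_ge0 ?invr_ge0 ?ler0n //.
    exact: le_trans (cb k.+2) (HD k.+1).
  have t0 := sqrt_gt0 k.+1; have := sqrt_sqr k.+2.
  set t := Num.sqrt k.+2%:R in t0 * => <-.
  rewrite [leLHS](_ : _ = D / (k.+1%:R * t)); last by field; rewrite nat1r pnatr_eq0 gt_eqF.
  by rewrite ler_pM2l // lef_pV2 ?posrE ?mulr_gt0 ?sqrt_gt0 ?ltr0n // ler_pM2l ?ltr0n // sqrt_le.
pose G := D / N (s - 1).
have G0 : 0 <= G by rewrite divr_ge0 ?ltW.
have cG n k : (n <= k)%N -> N (c k.+1 / (k.+1%:R * (s - 1))) <= G / Num.sqrt n.+1%:R.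
  move=> nk; apply: (@le_trans _ _ (G / Num.sqrt k.+1%:R)); last first.
    by rewrite ler_wpM2l // lef_pV2 ?posrE ?sqrt_gt0 // sqrt_le.
  rewrite Normc.normcM Normc.normcV (Normc.normcM k.+1%:R) normc_nat.
  have -> : G / Num.sqrt k.+1%:R = D * Num.sqrt k.+1%:R / (k.+1%:R * N (s - 1)).
    have t0 := sqrt_gt0 k; have := sqrt_sqr k.+1.
    set t := Num.sqrt k.+1%:R in t0 * => <-; rewrite /G.
    by field; rewrite !gt_eqF.
  rewrite ler_wpM2r ?invr_ge0 ?mulr_ge0 ?ler0n ?normc_ge0 //.
  exact: le_trans (cb k.+1) (HD k).
exists (6 * F + 2 * G) => [|n m nm]; first by apply: addr_ge0; apply: mulr_ge0.
have -> : psum (wcoef z (Some j :: w)) m - psum (wcoef z (Some j :: w)) n =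
    (E m - E n) + c m.+1 / (m.+1%:R * (s - 1)) - c n.+1 / (n.+1%:R * (s - 1)).
  by rewrite /E; move: (c m.+1 / _) (c n.+1 / _) => u v; ring.
apply: le_trans (normcB _ _) _; apply: le_trans (lerD (normcD _ _) (lexx _)) _.
have -> : (6 * F + 2 * G) / Num.sqrt n.+1%:R =
    6 * F / Num.sqrt n.+1%:R + G / Num.sqrt n.+1%:R + G / Num.sqrt n.+1%:R by ring.
apply: lerD; last exact: cG.
by apply: lerD; [apply: (tail_bound F0 HE)|apply: cG].
Qed.

(** In the fourth power the denominator is [(n+1)^2]: one factor absorbs the logarithms by
    [hsumX_bound], the other tends to infinity. *)
Lemma ge0_vanish (x C : R) k : 0 <= x -> 0 <= C ->
  (forall n, x <= C * h n ^+ k / Num.sqrt n.+1%:R) -> x = 0.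
Proof.
move=> x0 C0 H; have [D D0 HD] := hsumX_bound R (k * 4).
have H4 n : x ^+ 4 * n.+1%:R <= C ^+ 4 * D.
  have t0 := sqrt_gt0 n; have tt := sqrt_sqr n.+1.
  set t := Num.sqrt n.+1%:R in t0 tt *.
  have y0 : 0 <= C * h n ^+ k / t by rewrite divr_ge0 ?(ltW t0) // mulr_ge0 ?hsumX_ge0.
  have : x ^+ 4 <= (C * h n ^+ k / t) ^+ 4 by rewrite lerXn2r ?nnegrE.
  rewrite !exprMn -exprM exprVn => Hx.
  have Hh := HD n; rewrite -tt in Hh *.
  have {}Hx : x ^+ 4 <= C ^+ 4 * (D * (t * t)) / t ^+ 4.
    apply: le_trans Hx _; rewrite ler_wpM2r ?invr_ge0 ?exprn_ge0 ?(ltW t0) //.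
    by rewrite ler_wpM2l ?exprn_ge0.
  apply: le_trans (ler_wpM2r _ Hx) _; first by rewrite mulr_ge0 ?(ltW t0).
  by rewrite [leLHS](_ : _ = C ^+ 4 * D) //; field; rewrite gt_eqF.
apply/eqP; apply: contraT => xn0.
have x4 : 0 < x ^+ 4 by rewrite exprn_gt0 // lt_def xn0.
pose y := C ^+ 4 * D / x ^+ 4.
have y0 : 0 <= y by rewrite divr_ge0 ?(ltW x4) // mulr_ge0 ?exprn_ge0 // ltW.
have := archi_boundP y0; rewrite ltNge => /negP[].
apply: le_trans (_ : (Num.Def.archi_bound y).+1%:R <= _); first by rewrite ler_nat.
by rewrite ler_pdivlMr // mulrC.
Qed.

(** Every [v m - e m] lies below every [v n + e n], so the supremum of the former is within [e n] of
    each [v n] and is the limit. The shift between [u] and [v] is that of [partial_sumE]. *)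
Lemma limn_rate (u v : nat -> R) (C : R) : 0 <= C -> (forall n, u n.+1 = v n) ->
  (forall n m, (n <= m)%N -> `|v m - v n| <= C / Num.sqrt n.+1%:R) ->
  forall n, `|v n - limn u| <= C / Num.sqrt n.+1%:R.
Proof.
move=> C0 uv Hv; pose e n := C / Num.sqrt n.+1%:R.
have e_le m n : v m - e m <= v n + e n.
  rewrite lerBlDr -addrA -lerBlDl.
  have [nm|mn] := leqP n m.
    apply: le_trans (ler_norm _) _; apply: le_trans (Hv _ _ nm) _.
    by rewrite lerDl divr_ge0 ?sqrtr_ge0.
  rewrite -[v m - v n]opprB; apply: le_trans (ler_norm _) _; rewrite normrN.
  apply: le_trans (Hv _ _ (ltnW mn)) _.
  by rewrite lerDr divr_ge0 ?sqrtr_ge0.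
pose S : set R := range (fun n => v n - e n).
have Sub : has_ubound S by exists (v 0%N + e 0%N) => _ [m _ <-].
have Hl n : `|sup S - v n| <= e n.
  rewrite ler_norml; apply/andP; split.
    by rewrite lerBrDl; apply: ub_le_sup => //; exists n.
  rewrite lerBlDl; apply: ge_sup; first by exists (v 0%N - e 0%N), 0%N.
  by move=> _ [m _ <-].
suff -> : limn u = sup S by move=> n; rewrite distrC.
apply/cvg_lim => //; apply/cvgrPdist_le => d d0.
(* [e n <= d] holds once [n + 1 >= (C / d)^2]. *)
have y0 : 0 <= (C / d) ^+ 2 by rewrite sqr_ge0.
exists (Num.Def.archi_bound ((C / d) ^+ 2)).+1 => // -[//|n] /= Hn.
rewrite uv; apply: le_trans (Hl n) _.
rewrite /e ler_pdivrMr ?sqrt_gt0 // mulrC -ler_pdivrMr //.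
rewrite -[C / d]ger0_norm ?divr_ge0 ?(ltW d0) // -sqrtr_sqr ler_wsqrtr //.
apply: ltW; apply: lt_le_trans (archi_boundP y0) _.
by rewrite ler_nat ltnW.
Qed.

(** [Lsh_word] takes limits of real and imaginary parts separately, so the rate is obtained for each
    part and the constant doubles. *)
Lemma Lsh_word_rate w : convergent_word w ->
  exists2 C : R, 0 <= C & forall n,
    N (psum (wcoef z w) n - Lsh_word R w) <= C / Num.sqrt n.+1%:R.
Proof.
move=> Hw; have [C C0 HC] := psum_wcoef_cauchy Hw.
have yw : yend w by case: w Hw {HC} => [//|u w] /= /andP[]; rewrite yend_cons; case: w.
have ReIm (a : K) : `|complex.Re a| <= N a /\ `|complex.Im a| <= N a.
  case: a => a b /=; split; rewrite -sqrtr_sqr ler_wsqrtr //.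
    by rewrite lerDl sqr_ge0.
  by rewrite lerDr sqr_ge0.
have NRI (a : K) : N a <= `|complex.Re a| + `|complex.Im a|.
  case: a => a b /=.
  rewrite -[leRHS]ger0_norm ?addr_ge0 // -sqrtr_sqr ler_wsqrtr //.
  by rewrite sqrrD !real_normK ?num_real // lerD2r lerDl mulrn_wge0 ?mulr_ge0.
have HRe := @limn_rate (fun M => complex.Re (partial_sum R w M))
  (fun n => complex.Re (psum (wcoef z w) n)) C C0.
have HIm := @limn_rate (fun M => complex.Im (partial_sum R w M))
  (fun n => complex.Im (psum (wcoef z w) n)) C C0.
exists (C + C) => [|n]; first exact: addr_ge0.
apply: le_trans (NRI _) _; rewrite mulrDl; apply: lerD.
  rewrite /Lsh_word [complex.Re _]raddfB /=; apply: HRe => [k|k m km].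
    by rewrite partial_sumE.
  have := (ReIm (psum (wcoef z w) m - psum (wcoef z w) k)).1.
  rewrite raddfB /= => /le_trans; apply; exact: HC.
rewrite /Lsh_word [complex.Im _]raddfB /=; apply: HIm => [k|k m km].
  by rewrite partial_sumE.
have := (ReIm (psum (wcoef z w) m - psum (wcoef z w) k)).2.
  rewrite raddfB /= => /le_trans; apply; exact: HC.
Qed.

End Convergence.

(** * Vanishing *)

Section Support.
Variables (K : numFieldType) (r : nat) (hr : (0 < r)%N).
Local Notation A := {freeg (word r) / K}.

Definition supported (S : pred (word r)) (g : A) := forall w, coeff w g != 0 -> S w.

Lemma supported_word (S : pred (word r)) w : S w -> supported S << w >>.
Proof.
move=> Sw v; rewrite coeffU mul1r.
by have [<-|//] := eqVneq w v; rewrite ?eqxx.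
Qed.

Lemma supported0 S : supported S 0.
Proof. by move=> w; rewrite coeff0 eqxx. Qed.

Lemma supportedD S g g' : supported S g -> supported S g' -> supported S (g + g').
Proof.
move=> Hg Hg' w; rewrite coeffD; have [/Hg //|/negPn/eqP ->] := boolP (coeff w g != 0).
by rewrite add0r; apply: Hg'.
Qed.

Lemma supportedZ S c g : supported S g -> supported S (c *: g).
Proof. by move=> Hg w; rewrite coeffZ mulf_eq0 negb_or => /andP[_ /Hg]. Qed.

Lemma supportedN S g : supported S g -> supported S (- g).
Proof. by rewrite -scaleN1r; apply: supportedZ. Qed.

Lemma supported_ind (S : pred (word r)) (P : A -> Prop) : P 0 ->
  (forall c g g', P g -> P g' -> P (c *: g + g')) ->
  (forall w, S w -> P << w >>) -> forall g, supported S g -> P g.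
Proof.
move=> P0 PD Pw g Hg; rewrite -(freeg_sumE g) big_seq; elim/big_ind: _ => //.
  by move=> g1 g2 h1 h2; rewrite -[g1]scale1r; apply: PD.
move=> w; rewrite mem_dom => /Hg Sw.
rewrite -[coeff w g]mulr1 -scale_freegU -[_ *: _]addr0.
by apply: PD => //; apply: Pw.
Qed.

Lemma supported_lmul (S S' : pred (word r)) u g : (forall w, S w -> S' (u :: w)) ->
  supported S g -> supported S' (lmul u g).
Proof.
move=> SS; elim/supported_ind => [|c g1 g2 H1 H2|w Sw].
- by rewrite lmul0; apply: supported0.
- by rewrite lmulD lmulZ; apply: supportedD => //; apply: supportedZ.
- by rewrite lmulU; apply: supported_word; apply: SS.
Qed.

Local Notation yend := (@yend r).

Lemma yend_lmul u w : yend w -> yend (u :: w).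
Proof. by rewrite yend_cons; case: w. Qed.

Lemma supported_d1_split (S : pred (word r)) u F w :
  (forall v, yend v -> S (None :: v)) -> (forall v, yend v -> S (u :: v)) ->
  (forall v, yend v -> supported yend (F << v >>)) ->
  yend (u :: w) -> supported S (d1_split hr u F << w >> : A).
Proof.
move=> SN Su HF yw; case: u Su yw => [j|] Su yw; rewrite d1_splitE !lmulU.
  have yj (i : 'I_r) : yend (Some i :: w).
    by move: yw; rewrite !yend_cons; case: (w).
  apply: supportedD; [apply: supportedD|]; [|apply: supportedN|apply: supportedN];
    (apply: supported_lmul; last exact/HF/yj) => //.
apply: supported_lmul SN _; apply: HF.
by move: yw; rewrite !yend_cons; case: (w).
Qed.

Lemma supported_opA e g : supported yend g -> supported yend (opA hr e g).
Proof.
elim: e g => [|e IH|e IH|e IHe f IHf|k e IH] g Hg; rewrite ?opAE //.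
- rewrite zmulE.
  by apply: supportedD; apply: supported_lmul (yend_lmul _) _; apply: IH.
- elim/supported_ind: g / Hg => [|c g1 g2 H1 H2|w].
  + by rewrite opA0; apply: supported0.
  + by rewrite opAD opAZ; apply: supportedD => //; apply: supportedZ.
  + elim: w => [//|u w IHw] yw; rewrite -lmulU opA_J; apply: supportedD.
      case: w IHw yw => [|v w] IHw yw; last first.
        by apply: supported_lmul (yend_lmul u) _; apply: IHw.
      by rewrite opA_J1 lmul0; apply: supported0.
    apply: supported_d1_split yw; try exact: yend_lmul.
    by move=> v yv; apply: IH; apply: supported_word.
- by apply: supportedD; [apply: IHe|apply: IHf].
- by apply: supportedZ; apply: IH.
Qed.

(** Each word produced from [u :: w] begins with [u] or x, so y_1 never becomes a first letter; the
    last letter is controlled by [supported_opA]. *)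
Lemma supported_opA_J e w : convergent_word w ->
  supported (@convergent_word r) (opA hr (Jop e) << w >>).
Proof.
case: w => [//|u w] /andP[yw Hu]; rewrite -lmulU opA_J.
have Su v : yend v -> convergent_word (u :: v) by move=> yv; apply/andP.
apply: supportedD.
  by apply: supported_lmul Su _; apply/supported_opA/supported_word.
apply: supported_d1_split => //; last exact: yend_lmul.
- by move=> v yv; rewrite /= yv.
- by move=> v yv; apply/supported_opA/supported_word.
Qed.

Lemma adm_wordE (w : word r) : adm_word w = (w == [::]) || convergent_word w.
Proof. by case: w => [//|u [//|v w]]. Qed.

End Support.

Section Vanishing.
Variables (R : realType) (r : nat) (hr : (0 < r)%N).
Local Notation K := R[i].
Local Notation N := (@Normc.normc R).
Local Notation z := (zeta r R).
Local Notation A := {freeg (word r) / K}.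

Definition Llin : A -> K := fglift (fun w => Lsh_word R w : K^o).
Definition psum_lin n : A -> K := fglift (fun w => psum (wcoef z w) n : K^o).

Lemma LlinP c g g' : Llin (c *: g + g') = c * Llin g + Llin g'.
Proof. by rewrite /Llin linearP. Qed.

Lemma psum_linP n c g g' : psum_lin n (c *: g + g') = c * psum_lin n g + psum_lin n g'.
Proof. by rewrite /psum_lin linearP. Qed.

Lemma Llin0 : Llin 0 = 0.
Proof. by rewrite /Llin linear0. Qed.

Lemma psum_lin0 n : psum_lin n 0 = 0.
Proof. by rewrite /psum_lin linear0. Qed.

Lemma psum_lin_rho n g : supported (@yend r) g -> psum_lin n g = btrans (rho z g) n.
Proof.
elim/supported_ind => [|c g1 g2 H1 H2|w yw].
- rewrite psum_lin0 (_ : rho z 0 = fun m => if m == 0%N then 0 else 0).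
    by rewrite btrans_delta.
  by apply/funext => m; rewrite rho0; case: ifP.
- rewrite psum_linP H1 H2 -btrans_lin; apply: eq_btrans => m.
  by rewrite rhoD rhoZ.
- rewrite /psum_lin liftU1 psum_wcoef ?yw ?orbT //; apply: eq_btrans => m.
  by rewrite rhoU.
Qed.

Lemma psum_lin_rate g : supported (@convergent_word r) g ->
  exists2 C : R, 0 <= C & forall n, N (psum_lin n g - Llin g) <= C / Num.sqrt n.+1%:R.
Proof.
elim/supported_ind => [|c g1 g2 [C1 C10 H1] [C2 C20 H2]|w cw].
- by exists 0 => // n; rewrite psum_lin0 Llin0 subrr normc_0 mul0r.
- exists (N c * C1 + C2) => [|n].
    by apply: addr_ge0 => //; apply: mulr_ge0 => //; apply: normc_ge0.
  rewrite psum_linP LlinP.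
  have -> : c * psum_lin n g1 + psum_lin n g2 - (c * Llin g1 + Llin g2) =
    c * (psum_lin n g1 - Llin g1) + (psum_lin n g2 - Llin g2) by ring.
  apply: le_trans (normcD _ _) _; rewrite mulrDl; apply: lerD => //.
  by rewrite Normc.normcM -mulrA ler_wpM2l ?normc_ge0.
- have [C C0 H] := Lsh_word_rate R cw; exists C => // n.
  by rewrite /psum_lin /Llin !liftU1.
Qed.

Lemma convergent_yend (w : word r) : convergent_word w -> yend w.
Proof. by case: w => [//|u w] /andP[yw _]; apply: yend_lmul. Qed.

Lemma Llin_opA_J e w : adm_word w -> Llin (opA hr (Jop e) << w >>) = 0.
Proof.
rewrite adm_wordE => /orP[/eqP -> |cw].
  by rewrite opA_J1 Llin0.
have yw := convergent_yend cw.
set g := opA hr (Jop e) << w >>.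
have cg : supported (@convergent_word r) g by exact: supported_opA_J.
have yg : supported (@yend r) g by move=> v /cg /convergent_yend.
have [C C0 HC] := psum_lin_rate cg.
have [D D0 HD] := Lsh_word_rate R cw.
have [B [d HB]] := opseq_multiplier e; have [B0 _] := HB.
(* The value at [0] may be changed since [jseq _ 0 = 0]; with the value
   [- Lsh_word w] the transform becomes the remainder of the series, which decays. *)
pose a m := wseq z w m + (if m == 0%N then - Lsh_word R w else 0).
have Ha n : N (btrans a n) <= D / Num.sqrt n.+1%:R.
  by rewrite btransD btrans_delta -psum_wcoef ?yw ?orbT.
have Hg n : psum_lin n g = btrans (fun m => jseq (opseq e) m * a m) n.
  rewrite psum_lin_rho //; apply: eq_btrans => m; rewrite rho_op rhoU /a.
  by case: m => [|m] /=; rewrite ?jseq0 ?mul0r // addr0.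
apply: (@Normc.eq0_normc R).
(* [C] bounds the remainder of the series of [g]; [4 * B * D] bounds its partial sums, by
   [btrans_jseq_decay] applied to [a]. *)
apply: (@ge0_vanish _ _ (C + 4 * B * D) d.+1).
- exact: normc_ge0.
- by rewrite addr_ge0 ?mulr_ge0.
- move=> n; have -> : Llin g = psum_lin n g - (psum_lin n g - Llin g) by ring.
  apply: le_trans (normcB _ _) _; rewrite addrC [(C + _) * _]mulrDl mulrDl; apply: lerD.
    apply: le_trans (HC n) _; rewrite ler_wpM2r ?invr_ge0 ?sqrtr_ge0 //.
    by rewrite ler_peMr // hsumX_ge1.
  by rewrite Hg; apply: btrans_jseq_decay.
Qed.

Lemma LshE (P : fpoly r) : Lsh R P = Llin (freeg_of K P).
Proof.
rewrite /Llin /freeg_of linear_sum; apply: eq_bigr => t _.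
by rewrite linearZ /= liftU1.
Qed.

Lemma inA0_freeg_of (P : fpoly r) : inA0 P <-> supported (@adm_word r) (freeg_of K P).
Proof. by split=> H w; have := H w; rewrite coeff_freeg_of fmorph_eq0. Qed.

End Vanishing.

Unset Implicit Arguments.
Set Strict Implicit.

Theorem theorem4p14 (R : realType) (r : nat) (hr : (0 < r)%N) (n : nat)
  (hn : (1 <= n)%N) (c : rat) (P : fpoly r) :
  inA0 P -> inA0 (dhat hr c n P) /\ Lsh R (dhat hr c n P) = 0.
Proof.
case: n hn => [//|n] _ /(inA0_freeg_of R) HP.
rewrite (inA0_freeg_of R) LshE freeg_of_dhat; set e := dhat_op _ n; set k := _^-1.
suff [Hs HL] : supported (@adm_word r) (opA hr (Jop e) (freeg_of R[i] P)) /\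
    Llin (opA hr (Jop e) (freeg_of R[i] P)) = 0.
  split; first exact: supportedZ.
  by rewrite -[_ *: _]addr0 LlinP HL Llin0 mulr0 addr0.
elim/supported_ind: (freeg_of _ P) / HP => [|a g g' [H1 L1] [H2 L2]|w aw].
- by rewrite opA0 Llin0; split=> //; apply: supported0.
- rewrite opAD opAZ LlinP L1 L2 mulr0 addr0; split=> //.
  by apply: supportedD => //; apply: supportedZ.
- split; last exact: Llin_opA_J.
  move: aw; rewrite adm_wordE => /orP[/eqP -> |cw].
    by rewrite opA_J1; apply: supported0.
  by move=> v /(supported_opA_J cw) cv; rewrite adm_wordE cv orbT.
Qed.
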